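(* Let $b,\sigma:[0,T]\times\mathbb{R}^d\to\mathbb{R}^d$ be continuous and satisfy the assumptions $(H_1)$ and $(H_2)$ stated in the context, and let $1-H<\alpha<\alpha_0$. Let $K(t)=\overline{K(t)}\subset\mathbb{R}^d$, $t\in[0,T]$, be a family of closed sets, and let $\varphi:\mathbb{R}^d\to\mathbb{R}^m$ be a $C^2$ map with bounded second derivative. Let $t\in[0,T]$ and $x\in K(t)$. If $$(b(t,x),\sigma(t,x))\in S_{K(t)}(t,x),$$ then $$(\varphi'(x)b(t,x),\varphi'(x)\sigma(t,x))\in S_{\varphi(K(t))}(t,\varphi(x)).$$
   Context: Fix $T>0$, $d,m\ge 1$, $H\in(\frac12,1)$ and a real-valued fractional Brownian motion $B^H=\{B^H_t,t\ge 0\}$ with Hurst parameter $H$ on a complete probability space $(\Omega,\mathcal F,\mathbb P)$. Integrals with respect to $B^H$ are pathwise Riemann-Stieltjes (Young) integrals. $(H_1)$: $\sigma(t,x)$ is differentiable in $x$, and there are constants $\beta,\delta\in(0,1]$, $M_0>0$, and for every $\rho>0$ a constant $M_\rho>0$, such that for all $s,t\in[0,T]$: (i) $|\sigma(t,x)-\sigma(s,y)|\le M_0(|t-s|^\beta+|x-y|)$ for all $x,y\in\mathbb{R}^d$; (ii) $|\nabla_x\sigma(t,y)-\nabla_x\sigma(s,z)|\le M_\rho(|t-s|^\beta+|y-z|^\delta)$ for all $|y|,|z|\le \rho$. Set $\alpha_0=\min\{\frac12,\beta,\frac{\delta}{1+\delta}\}$ and $M_{0,T}=|\sigma(0,0)|+M_0+M_0T$.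 $(H_2)$: there are $\mu\in(1-\alpha_0,1]$, $L_0>0$, and for every $\rho\ge0$ a constant $L_\rho>0$, such that for all $s,t\in[0,T]$: (i) $|b(t,x)-b(s,y)|\le L_\rho(|t-s|^\mu+|x-y|)$ for all $|x|,|y|\le\rho$; (ii) $|b(t,x)|\le L_0(1+|x|)$ for all $x\in\mathbb{R}^d$. Let $\Lambda_\alpha(B^H)=\frac{1}{\Gamma(1-\alpha)\Gamma(\alpha)}\sup_{0<r<s<T}\left|\frac{B^H_r-B^H_s}{(s-r)^{1-\alpha}}+(1-\alpha)\int_r^s\frac{B^H_r-B^H_y}{(y-r)^{2-\alpha}}dy\right|$. Tangent set: for $t\in[0,T]$, $x\in K(t)$, the $(1-\alpha)$-fractional $B^H$-tangent set $S_{K(t)}(t,x)$ to $K(t)$ in $x$ is the set of pairs $(u,v)\in\mathbb{R}^d\times\mathbb{R}^d$ for which there exist a random variable $\bar h=\bar h^{t,x}>0$ and two stochastic processes $U=U^{t,x},V=V^{t,x}:\Omega\times[t,t+\bar h]\to\mathbb{R}^d$ with $U(t)=V(t)=0$, and, for every $\rho>0$ with $|x|\le\rho$, two random variables $D_\rho,\tilde D_\rho>0$, which do not depend on $(t,\bar h)$ and depend only on $\rho,L_\rho,M_{0,T},M_0,L_0,T,\alpha,\beta,\Lambda_\alpha(B^H)$, such that $\mathbb P$-a.s. for all $s,\tau\in[t,t+\bar h]$ $$|U(s)-U(\tau)|\le D_\rho|s-\tau|^{1-\alpha},\qquad |V(s)-V(\tau)|\le\tilde D_\rho|s-\tau|^{\min\{\beta,1-\alpha\}},$$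 $$x+\int_t^s(u+U(r))dr+\int_t^s(v+V(r))dB^H_r\in K(s).$$ The set $S_{\varphi(K(t))}(t,\varphi(x))$ is defined in the same way, with pairs $(u,v)\in\mathbb{R}^m\times\mathbb{R}^m$ and $\mathbb{R}^m$-valued processes $U,V$, the last condition being replaced by $\varphi(x)+\int_t^s(u+U(r))dr+\int_t^s(v+V(r))dB^H_r\in\varphi(K(s))$. *)

(* Defs.v *)
From HB Require Import structures.
From mathcomp Require Export all_boot all_order all_algebra.
From mathcomp Require Export all_classical all_reals all_analysis.
From mathcomp Require Export measurable_realfun.
Export Order.TTheory GRing.Theory Num.Theory.
Export numFieldNormedType.Exports.

Set Implicit Arguments.
Unset Strict Implicit.
Unset Printing Implicit Defensive.

#[export] Set Implicit Arguments.
#[export] Unset Strict Implicit.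
#[export] Unset Printing Implicit Defensive.

Local Open Scope classical_set_scope.
Local Open Scope ring_scope.

(* Euclidean norm of a row vector, Frobenius norm of a matrix; the library norm
   of a matrix is the maximum of the absolute values of its entries. *)
Definition enorm (R : realType) (p q : nat) (A : 'M[R]_(p, q)) : R :=
  Num.sqrt (\sum_(i < p) \sum_(j < q) A i j ^+ 2).

Definition Gamma (R : realType) (a : R) : R :=
  \int[@lebesgue_measure R]_(x in `]0, +oo[) (x `^ (a - 1) * expR (- x)).

(* The partition is a = p_0 < ... < p_n = b with s = [:: p_1; ...; p_n], and
   tau i is the tag in [p_i, p_(i+1)].  For a = b the only partition has s = [::],
   so that the integral is 0. *)
Definition RS_sum (R : realType) (f g : R -> R) (a : R) (s : seq R)
    (tau : nat -> R) : R :=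
  \sum_(i < size s) f (tau i) * (g (nth a (a :: s) i.+1) - g (nth a (a :: s) i)).

Definition is_RS_integral (R : realType) (f g : R -> R) (a b I : R) : Prop :=
  forall e : R, 0 < e -> exists2 eta : R, 0 < eta &
    forall (s : seq R) (tau : nat -> R), itv_partition a b s ->
      (forall i, (i < size s)%N ->
         [/\ nth a (a :: s) i.+1 - nth a (a :: s) i < eta,
             nth a (a :: s) i <= tau i & tau i <= nth a (a :: s) i.+1]) ->
      `| RS_sum f g a s tau - I | < e.

(* Degenerate laws are allowed: [normal_prob m 0] is not the Dirac mass at m. *)
Definition gaussian_rv (disp : measure_display) (Omega : measurableType disp)
    (R : realType) (P : probability Omega R) (X : Omega -> R) : Prop :=
  measurable_fun setT X /\
  exists m s : R, 0 <= s /\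
    forall A : set R, measurable A ->
      P (X @^-1` A) = if s == 0 then \d_m A else normal_prob m s A.

Record fractional_brownian_motion (disp : measure_display)
    (Omega : measurableType disp) (R : realType) (P : probability Omega R)
    (H : R) (B : R -> Omega -> R) : Prop := FractionalBrownianMotion {
  fbm_gaussian : forall (n : nat) (c t : 'I_n -> R), (forall i, 0 <= t i) ->
    gaussian_rv P (fun w => \sum_(i < n) c i * B (t i) w);
  fbm_mean : forall t : R, 0 <= t -> ('E_P[B t] = 0)%E;
  fbm_cov : forall s t : R, 0 <= s -> 0 <= t ->
    ('E_P[(fun w => B s w * B t w)%R] =
      ((s `^ (2 * H) + t `^ (2 * H) - `|t - s| `^ (2 * H)) / 2)%:E)%E;
  fbm_continuous : {ae P, forall w, {within `[0, +oo[, continuous (B ^~ w)}}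
}.

Definition Lambda (R : realType) (alpha T : R) (g : R -> R) : \bar R :=
  (((Gamma (1 - alpha) * Gamma alpha)^-1)%:E *
   ereal_sup [set e : \bar R | exists r s : R, [/\ (0 < r)%R, (r < s)%R, (s < T)%R &
     e = (`| (g r - g s) / (s - r) `^ (1 - alpha) +
             (1 - alpha) * \int[@lebesgue_measure R]_(y in `[r, s])
                             ((g r - g y) / (y - r) `^ (2 - alpha)) |)%:E]])%E.

Record assumption_H1 (R : realType) (d : nat) (T : R)
    (sigma : R -> 'rV[R]_d -> 'rV[R]_d) (beta delta M0 : R) (M : R -> R)
    : Prop := AssumptionH1 {
  H1_beta : 0 < beta <= 1;
  H1_delta : 0 < delta <= 1;
  H1_M0 : 0 < M0;
  H1_M : forall rho : R, 0 < rho -> 0 < M rho;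
  H1_diff : forall (t : R) (x : 'rV[R]_d), 0 <= t <= T -> differentiable (sigma t) x;
  H1_lip : forall (s t : R) (x y : 'rV[R]_d), 0 <= s <= T -> 0 <= t <= T ->
    enorm (sigma t x - sigma s y) <= M0 * (`|t - s| `^ beta + enorm (x - y));
  H1_grad : forall rho : R, 0 < rho ->
    forall (s t : R) (y z : 'rV[R]_d), 0 <= s <= T -> 0 <= t <= T ->
    enorm y <= rho -> enorm z <= rho ->
    enorm (jacobian (sigma t) y - jacobian (sigma s) z) <=
      M rho * (`|t - s| `^ beta + enorm (y - z) `^ delta)
}.

Definition alpha0 (R : realType) (beta delta : R) : R :=
  Num.min (1 / 2) (Num.min beta (delta / (1 + delta))).

Definition M0T (R : realType) (d : nat) (T : R)
    (sigma : R -> 'rV[R]_d -> 'rV[R]_d) (M0 : R) : R :=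
  enorm (sigma 0 0) + M0 + M0 * T.

Record assumption_H2 (R : realType) (d : nat) (T : R)
    (b : R -> 'rV[R]_d -> 'rV[R]_d) (a0 mu L0 : R) (L : R -> R)
    : Prop := AssumptionH2 {
  H2_mu : 1 - a0 < mu <= 1;
  H2_L0 : 0 < L0;
  H2_L : forall rho : R, 0 <= rho -> 0 < L rho;
  H2_lip : forall rho : R, 0 <= rho ->
    forall (s t : R) (x y : 'rV[R]_d), 0 <= s <= T -> 0 <= t <= T ->
    enorm x <= rho -> enorm y <= rho ->
    enorm (b t x - b s y) <= L rho * (`|t - s| `^ mu + enorm (x - y));
  H2_growth : forall (t : R) (x : 'rV[R]_d), 0 <= t <= T -> enorm (b t x) <= L0 * (1 + enorm x)
}.

(* phi is twice Frechet differentiable, phi'' is continuous and bounded (in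
   finite dimension, continuity of x |-> phi''(x) is continuity along each v). *)
Record C2_bounded_second_derivative (R : realType) (d m : nat)
    (phi : 'rV[R]_d -> 'rV[R]_m) : Prop := C2BoundedSecondDerivative {
  C2_diff1 : forall x, differentiable phi x;
  C2_diff2 : forall x, differentiable (jacobian phi) x;
  C2_continuous : forall v, continuous (fun x => 'd (jacobian phi) x v);
  C2_bounded : exists C : R, forall x v, `|'d (jacobian phi) x v| <= C * `|v|
}.

(* A random variable D_rho that depends only on rho, L_rho, M_{0,T}, M_0, L_0, T,
   alpha, beta and Lambda_alpha(B^H) is a function of these quantities, in this
   order, which is Borel in the last one, the only random one. *)
Definition bound (R : realType) : Type :=
  R -> R -> R -> R -> R -> R -> R -> R -> \bar R -> R.

Definition admissible_bound (R : realType) (D : bound R) : Prop :=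
  forall rho Lrho m0T m0 l0 T alpha beta : R,
    (forall lam : \bar R, 0 < D rho Lrho m0T m0 l0 T alpha beta lam) /\
    measurable_fun [set: \bar R] (D rho Lrho m0T m0 l0 T alpha beta).

Definition bound_at (R : realType) (D : bound R) (L : R -> R)
    (m0T m0 l0 T alpha beta : R) : R -> \bar R -> R :=
  fun rho => D rho (L rho) m0T m0 l0 T alpha beta.

(* The (1 - alpha)-fractional B-tangent set to F t in y, for given bounds D and Dt
   of the Hoelder constants.  The bounds are parameters because they are not allowed
   to depend on t and h.  The constants are indexed by the rho > 0 with r <= rho,
   where r is the norm of x both for (K, x) and for (phi(K), phi(x)): no
   bound on phi(x) controls phi'(x).  The families K and phi(K) are indexed by
   [0, T], hence the restriction s <= T in the last condition.  The processes U and
   V live on the random interval [t, t + h]. *)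
Definition tangent_set (disp : measure_display) (Omega : measurableType disp)
    (R : realType) (P : probability Omega R) (B : R -> Omega -> R)
    (T alpha beta : R) (D Dt : R -> \bar R -> R)
    (n : nat) (F : R -> set 'rV[R]_n) (t : R) (y : 'rV[R]_n) (r : R)
    : set ('rV[R]_n * 'rV[R]_n) :=
  [set uv : 'rV[R]_n * 'rV[R]_n | exists (h : Omega -> R) (U V : R -> Omega -> 'rV[R]_n),
    [/\ measurable_fun setT h /\ (forall w, 0 < h w),
        (forall (s : R) (i : 'I_n), t <= s ->
           measurable_fun [set w | s <= t + h w] (fun w => U s w 0 i)),
        (forall (s : R) (i : 'I_n), t <= s ->
           measurable_fun [set w | s <= t + h w] (fun w => V s w 0 i)),
        (forall w, U t w = 0 /\ V t w = 0) &
        forall rho : R, 0 < rho -> r <= rho ->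
          {ae P, forall w, forall s tau : R,
             t <= s <= t + h w -> t <= tau <= t + h w ->
             [/\ enorm (U s w - U tau w) <=
                   D rho (Lambda alpha T (B ^~ w)) * `|s - tau| `^ (1 - alpha),
                 enorm (V s w - V tau w) <=
                   Dt rho (Lambda alpha T (B ^~ w)) *
                     `|s - tau| `^ (Num.min beta (1 - alpha)) &
                 s <= T -> exists J : 'rV[R]_n,
                   (forall i, is_RS_integral
                      (fun q => uv.2 0 i + V q w 0 i) (B ^~ w) t s (J 0 i)) /\
                   F s (y +
                        \row_i (\int[@lebesgue_measure R]_(q in `[t, s])
                                  (uv.1 0 i + U q w 0 i)) +
                        J)]}]].

(* Main.v *)
(** Almost every path of the fractional Brownian motion B is gam-Hoelder for some
    1 - alpha < gam < H.  Let X be the path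
    s |-> x + \int_t^s (u + U) dr + \int_t^s (v + V) dB given by the tangency of
    (u, v); Young's estimate, applicable since min(beta, 1 - alpha) + gam > 1, shows
    that X is gam-Hoelder and that phi o X satisfies the change of variables formula.
    So the processes that witness the tangency of the image are
    U' = phi'(X)(u + U) - phi'(x) u and V' = phi'(X)(v + V) - phi'(x) v.

    Their Hoelder constants may only depend on the bounds for U and V, not on the
    Hoelder constant of X.  Since gam > 1 - alpha, the increments of X are at most
    |s - tau|^(1 - alpha) on a small random interval [t, t + h'], and U, V are at most 1
    there.  So h' is chosen as the largest 1/n for which these inequalities hold at
    the rational times: this is measurable, and no estimate by Lambda is required. *)

Require Import Defs.
From mathcomp Require Import ring lra zify.

Local Open Scope classical_set_scope.
Local Open Scope ring_scope.

(** * Young integration *)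

(** The tangency of (u, v) provides, for each outcome and each time, some value of the integral
    against B, with no measurability in the outcome. Hence X is rebuilt as a limit superior of
    dyadic left sums of the measurable processes U, V and B; Hoelder continuity makes these sums
    converge almost surely to the given integrals.

    The integrals admit arbitrary partitions and tags, and are given only on intervals that start at
    t. Both their use and their construction therefore go through a germ estimate: the increment of
    the integral over [a, b] differs from f(tau) (g(b) - g(a)), for every tag tau in [a, b], by at
    most C (b - a)^theta with theta > 1. In the change of variables formula the Taylor remainder has
    order 2 gam > 1, so it leaves no correction term.

    The sizes of u = b(t, x) and v = sigma(t, x) enter the new Hoelder constants through the product
    rule; the growth of b and sigma bounds them by L0, M0, M_{0,T} and rho. Since U' and V' must
    exist on all of [t, t + h'], possibly beyond T, time is stopped at T in them. *)

Fixpoint dyadic_sum (R : realType) (f g : R -> R) (n : nat) (a b : R) : R :=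
  if n is n'.+1 then
    dyadic_sum f g n' a ((a + b) / 2) + dyadic_sum f g n' ((a + b) / 2) b
  else f a * (g b - g a).

Fixpoint dyadic_partition (R : realType) (n : nat) (a b : R) : seq R :=
  if n is n'.+1 then
    dyadic_partition n' a ((a + b) / 2) ++ dyadic_partition n' ((a + b) / 2) b
  else [:: b].

(** The recursion on the partition makes sums with left tags additive under concatenation, so that a
    partition of [t, a] can be continued by a dyadic one of [a, b]. *)
Fixpoint left_sum (R : realType) (f g : R -> R) (a : R) (s : seq R) : R :=
  if s is b :: s' then f a * (g b - g a) + left_sum f g b s' else 0.

Lemma left_sum_cat (R : realType) (f g : R -> R) (a : R) (s s' : seq R) :
  left_sum f g a (s ++ s') = left_sum f g a s + left_sum f g (last a s) s'.
Proof. by elim: s a => [|b s IHs] a /=; rewrite ?add0r// IHs addrA. Qed.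

Lemma last_dyadic_partition (R : realType) (n : nat) (a b c : R) :
  last c (dyadic_partition n a b) = b.
Proof. by elim: n a b c => [|n IHn] a b c //=; rewrite last_cat !IHn. Qed.

Lemma left_sum_dyadic (R : realType) (f g : R -> R) (n : nat) (a b : R) :
  left_sum f g a (dyadic_partition n a b) = dyadic_sum f g n a b.
Proof.
elim: n a b => [|n IHn] a b /=; first by rewrite addr0.
by rewrite left_sum_cat last_dyadic_partition !IHn.
Qed.

Lemma dyadic_partition_path (R : realType) (eta : R) (n : nat) (a b : R) :
  a < b -> b - a < eta * 2 ^+ n ->
  path (fun x y => (x < y) && (y - x < eta)) a (dyadic_partition n a b).
Proof.
elim: n a b => [|n IHn] a b ab; first by rewrite expr0 mulr1 => h /=; rewrite ab h.
rewrite exprS mulrCA => h /=; rewrite cat_path last_dyadic_partition.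
by apply/andP; split; apply: IHn; lra.
Qed.

Lemma exists_fine_partition (R : realType) (eta a b : R) : 0 < eta -> a <= b ->
  exists2 s : seq R, path (fun x y => (x < y) && (y - x < eta)) a s & last a s = b.
Proof.
move=> eta0; rewrite le_eqVlt => /predU1P[->|ab]; first by exists [::].
pose n := Num.trunc ((b - a) / eta).
have hn : b - a < eta * 2 ^+ n.+1.
  rewrite mulrC -ltr_pdivrMr//; apply: lt_trans (truncnS_gt _) _.
  by rewrite -natrX ltr_nat ltn_expl.
exists (dyadic_partition n.+1 a b); last exact: last_dyadic_partition.
exact: dyadic_partition_path.
Qed.

Lemma RS_sum_left (R : realType) (f g : R -> R) (d a : R) (s : seq R) :
  \sum_(i < size s) f (nth d (a :: s) i) *
    (g (nth d (a :: s) i.+1) - g (nth d (a :: s) i)) = left_sum f g a s.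
Proof.
elim: s a => [|b s IHs] a /=; first by rewrite big_ord0.
by rewrite big_ord_recl /= -IHs.
Qed.

Lemma left_sum_RS_integral (R : realType) (f g : R -> R) (a b I : R) :
  is_RS_integral f g a b I -> forall e, 0 < e -> exists2 eta, 0 < eta &
  forall s, path (fun x y => (x < y) && (y - x < eta)) a s -> last a s = b ->
  `|left_sum f g a s - I| < e.
Proof.
move=> hI e e0; have [eta eta0 H] := hI e e0; exists eta => // s ps ls.
rewrite -(RS_sum_left f g a); apply: (H s (fun i => nth a (a :: s) i)).
  split; last by rewrite ls.
  by apply: sub_path ps => x y /andP[].
by move=> i hi; have /andP[h1 h2] := pathP a ps i hi; split => //=; exact: ltW.
Qed.

Lemma powR_half (R : realType) (x theta : R) : 0 <= x ->
  ((x / 2) `^ theta) *+ 2 = 2 `^ (1 - theta) * x `^ theta.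
Proof.
move=> x0; rewrite powRM ?invr_ge0// -powR_inv1// -powRrM mulN1r.
by rewrite powRD ?pnatr_eq0 ?implybT// powRr1// -mulr_natl; ring.
Qed.

Lemma powR2_lt1 (R : realType) (theta : R) : 1 < theta -> 0 <= (2 : R) `^ (1 - theta) < 1.
Proof.
move=> h; rewrite powR_ge0 -opprB powRN invf_lt1 ?powR_gt0//=.
by rewrite /powR pnatr_eq0/= -[ltLHS]expR0 ltr_expR mulr_gt0 ?ln_gt0 ?ltr1n// subr_gt0.
Qed.

Lemma dyadic_sum_rate (R : realType) (f g I : R -> R) (C theta t e : R) :
  (forall a b, t <= a -> a <= b -> b <= e ->
    `|I b - I a - f a * (g b - g a)| <= C * (b - a) `^ theta) ->
  forall n a b, t <= a -> a <= b -> b <= e ->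
  `|dyadic_sum f g n a b - (I b - I a)| <=
    C * (2 `^ (1 - theta)) ^+ n * (b - a) `^ theta.
Proof.
move=> H; elim=> [|n IHn] a b ta ab be /=.
  by rewrite expr0 mulr1 distrC; exact: H.
set c := (a + b) / 2.
have ac : a <= c by rewrite /c; lra.
have cb : c <= b by rewrite /c; lra.
have -> : dyadic_sum f g n a c + dyadic_sum f g n c b - (I b - I a) =
  (dyadic_sum f g n a c - (I c - I a)) + (dyadic_sum f g n c b - (I b - I c)) by ring.
apply: le_trans (ler_normD _ _) _.
apply: le_trans (lerD (IHn _ _ _ _ _) (IHn _ _ _ _ _)) _ => //.
- exact: le_trans be.
- exact: le_trans ac.
have -> : c - a = (b - a) / 2 by rewrite /c; lra.
have -> : b - c = (b - a) / 2 by rewrite /c; lra.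
rewrite -mulr2n -mulrnAr powR_half ?subr_ge0// exprSr; rewrite mulrA -mulrA.
by rewrite le_eqVlt !mulrA eqxx.
Qed.

Lemma dyadic_sum_cvg (R : realType) (f g I : R -> R) (C theta t e : R) :
  1 < theta -> t <= e ->
  (forall a b, t <= a -> a <= b -> b <= e ->
    `|I b - I a - f a * (g b - g a)| <= C * (b - a) `^ theta) ->
  dyadic_sum f g n t e @[n --> \oo] --> I e - I t.
Proof.
move=> th1 te H; apply/cvgrPdist_le => eps eps0.
have /andP[q0 q1] := powR2_lt1 th1.
have C0 : 0 <= C * (e - t) `^ theta.
  by apply: le_trans (H t e _ _ _).
have : (C * (e - t) `^ theta) * (2 `^ (1 - theta)) ^+ n @[n --> \oo] --> (C * (e - t) `^ theta) * 0.
  by apply: cvgMr; apply: cvg_expr; rewrite ger0_norm.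
rewrite mulr0 => /cvgrPdist_le/(_ _ eps0); apply: filterS => n.
rewrite sub0r normrN ger0_norm; last by rewrite mulr_ge0// exprn_ge0.
move=> h.
rewrite distrC; apply: le_trans (dyadic_sum_rate H n _ _ _) _ => //.
by rewrite mulrAC.
Qed.

Lemma hoelder_le (R : realType) (f : R -> R) (C lam t e a b p q : R) :
  0 <= lam -> 0 <= C ->
  (forall p q, t <= p <= e -> t <= q <= e -> `|f p - f q| <= C * `|p - q| `^ lam) ->
  t <= a -> b <= e -> a <= p -> p <= b -> a <= q -> q <= b ->
  `|f p - f q| <= C * (b - a) `^ lam.
Proof.
move=> lam0 C0 hf ta be ap pb aq qb.
apply: le_trans (hf _ _ _ _) _.
- by rewrite (le_trans ta)// (le_trans pb).
- by rewrite (le_trans ta)// (le_trans qb).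
have ab : a <= b by exact: le_trans pb.
rewrite ler_wpM2l// ge0_ler_powR ?nnegrE ?normr_ge0 ?subr_ge0//.
by rewrite ler_norml; apply/andP; split; lra.
Qed.

(* Splitting [a, b] at its midpoint c changes the left sum by
   (f c - f a) (g b - g c), of order (b - a)^(lam + gam), and the sum of the
   orders of the two halves is smaller by the factor 2^(1 - lam - gam). *)
Lemma dyadic_sum_young (R : realType) (f g : R -> R) (Cf Cg lam gam t e : R) :
  1 < lam + gam -> 0 <= lam -> 0 <= gam -> 0 <= Cf -> 0 <= Cg ->
  (forall p q, t <= p <= e -> t <= q <= e -> `|f p - f q| <= Cf * `|p - q| `^ lam) ->
  (forall p q, t <= p <= e -> t <= q <= e -> `|g p - g q| <= Cg * `|p - q| `^ gam) ->
  forall n a b, t <= a -> a <= b -> b <= e ->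
  `|dyadic_sum f g n a b - f a * (g b - g a)| <=
    Cf * Cg / (1 - 2 `^ (1 - (lam + gam))) * (b - a) `^ (lam + gam).
Proof.
move=> th1 lam0 gam0 Cf0 Cg0 hf hg.
have /andP[] := powR2_lt1 th1; set q := 2 `^ _ => q0 q1.
set K := Cf * Cg / (1 - q).
have K0 : 0 <= K by rewrite divr_ge0 ?mulr_ge0// subr_ge0 ltW.
(* [K] is chosen as the fixed point of the recursion: K q for the two halves plus Cf Cg for the
   midpoint term. *)
have KE : K * q + Cf * Cg = K by rewrite /K; field; lra.
elim=> [|n IHn] a b ta ab be /=.
  by rewrite subrr normr0 mulr_ge0// powR_ge0.
set c := (a + b) / 2.
have ac : a <= c by rewrite /c; lra.
have cb : c <= b by rewrite /c; lra.
have -> : dyadic_sum f g n a c + dyadic_sum f g n c b - f a * (g b - g a) =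
  (dyadic_sum f g n a c - f a * (g c - g a)) +
  (dyadic_sum f g n c b - f c * (g b - g c)) + (f c - f a) * (g b - g c) by ring.
have h1 : `|dyadic_sum f g n a c - f a * (g c - g a)| +
          `|dyadic_sum f g n c b - f c * (g b - g c)| <= K * q * (b - a) `^ (lam + gam).
  apply: le_trans (lerD (IHn _ _ _ _ _) (IHn _ _ _ _ _)) _ => //.
  - exact: le_trans be.
  - exact: le_trans ac.
  have -> : c - a = (b - a) / 2 by rewrite /c; lra.
  have -> : b - c = (b - a) / 2 by rewrite /c; lra.
  by rewrite -mulr2n -mulrnAr powR_half ?subr_ge0// mulrA.
have h2 : `|(f c - f a) * (g b - g c)| <= Cf * Cg * (b - a) `^ (lam + gam).
  rewrite normrM powRD; last by apply/implyP => /eqP; lra.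
  rewrite mulrACA; apply: ler_pM => //.
    exact: (hoelder_le lam0 Cf0 hf).
  exact: (hoelder_le gam0 Cg0 hg).
apply: le_trans (ler_normD _ _) _; rewrite -[X in _ <= X * _]KE [leRHS]mulrDl.
by apply: (lerD _ h2); exact: le_trans (ler_normD _ _) h1.
Qed.

(** Only the integrals from [t] are given, and no additivity in the interval. The increment
    [J b - J a] is approximated by extending one fine partition of [t, a] by a dyadic partition of
    [a, b]: the common part cancels, and [dyadic_sum_young] bounds what remains uniformly in the
    level. Moving the tag from [a] to [tau] costs another Cf Cg. *)
Lemma RS_integral_young (R : realType) (f g J : R -> R) (Cf Cg lam gam t e : R) :
  1 < lam + gam -> 0 <= lam -> 0 <= gam -> 0 <= Cf -> 0 <= Cg ->
  (forall p q, t <= p <= e -> t <= q <= e -> `|f p - f q| <= Cf * `|p - q| `^ lam) ->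
  (forall p q, t <= p <= e -> t <= q <= e -> `|g p - g q| <= Cg * `|p - q| `^ gam) ->
  (forall s, t <= s <= e -> is_RS_integral f g t s (J s)) ->
  exists2 K : R, 0 <= K & forall a tau b, t <= a -> a <= tau -> tau <= b -> b <= e ->
  `|J b - J a - f tau * (g b - g a)| <= K * (b - a) `^ (lam + gam).
Proof.
move=> th1 lam0 gam0 Cf0 Cg0 hf hg hJ.
have DY := dyadic_sum_young th1 lam0 gam0 Cf0 Cg0 hf hg.
set K := (_ / _) in DY.
have /andP[q0 q1] := powR2_lt1 th1.
have K0 : 0 <= K by rewrite divr_ge0 ?mulr_ge0// subr_ge0 ltW.
exists (K + Cf * Cg); first by rewrite addr_ge0// mulr_ge0.
move=> a tau b ta atau taub be.
have ab : a <= b by exact: le_trans taub.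
have h1 : `|J b - J a - f a * (g b - g a)| <= K * (b - a) `^ (lam + gam).
  have [->|neab] := eqVneq a b.
    by rewrite !subrr mulr0 subr0 normr0 mulr_ge0// powR_ge0.
  have ltab : a < b by rewrite lt_neqAle neab.
  apply/ler_addgt0Pr => eps eps0.
  have eps2 : 0 < eps / 2 by lra.
  have [ea ea0 Ha] : exists2 eta, 0 < eta &
      forall s, path (fun x y => (x < y) && (y - x < eta)) t s -> last t s = a ->
      `|left_sum f g t s - J a| < eps / 2.
    by apply: left_sum_RS_integral => //; apply: hJ; apply/andP; split; lra.
  have [eb eb0 Hb] : exists2 eta, 0 < eta &
      forall s, path (fun x y => (x < y) && (y - x < eta)) t s -> last t s = b ->
      `|left_sum f g t s - J b| < eps / 2.
    by apply: left_sum_RS_integral => //; apply: hJ; apply/andP; split; lra.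
  (* The partition of [t, a] has to be fine enough for both integrals at once. *)
  pose eta := Num.min ea eb.
  have eta0 : 0 < eta by rewrite lt_min ea0.
  have [p pp lp] := exists_fine_partition eta0 ta.
  pose n := (Num.trunc ((b - a) / eta)).+1.
  have hn : b - a < eta * 2 ^+ n.
    rewrite mulrC -ltr_pdivrMr//; apply: lt_trans (truncnS_gt _) _.
    by rewrite -natrX ltr_nat ltn_expl.
  have pq := dyadic_partition_path ltab hn.
  have wk c : eta <= c ->
      subrel (fun x y : R => (x < y) && (y - x < eta)) (fun x y : R => (x < y) && (y - x < c)).
    by move=> hc x y /andP[-> /lt_le_trans]; exact.
  have Aa := Ha p (sub_path (wk ea _) pp) lp.
  have := Hb (p ++ dyadic_partition n a b).
  rewrite cat_path last_cat lp last_dyadic_partition left_sum_cat lp left_sum_dyadic.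
  rewrite (sub_path (wk eb _) pp) ?ge_min ?lexx ?orbT//.
  rewrite (sub_path (wk eb _) pq) ?ge_min ?lexx ?orbT//.
  move=> /(_ isT erefl) Ab.
  have {}Aa := Aa _; rewrite ge_min lexx in Aa; have {}Aa := Aa isT.
  have D := DY n a b ta ab be.
  move: Aa Ab D; rewrite !ltr_norml !ler_norml.
  move=> /andP[? ?] /andP[? ?] /andP[? ?]; apply/andP; split; lra.
have h2 : `|(f a - f tau) * (g b - g a)| <= Cf * Cg * (b - a) `^ (lam + gam).
  rewrite normrM powRD; last by apply/implyP => /eqP; lra.
  rewrite mulrACA; apply: ler_pM => //.
    exact: (hoelder_le lam0 Cf0 hf).
  exact: (hoelder_le gam0 Cg0 hg).
rewrite mulrDl; apply: le_trans (lerD h1 h2); apply: le_trans (ler_normD _ _).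
by rewrite le_eqVlt; apply/orP; left; apply/eqP; congr `|_|; ring.
Qed.

(** This is the converse of [RS_integral_young]. Over a partition the increments of [I] telescope,
    and the germ errors sum to at most C (s - t) mesh^(theta - 1), whatever the tags; thus existence
    and value of the integral come together. *)
Lemma RS_integral_of_germ (R : realType) (f g I : R -> R) (C theta t s : R) :
  1 < theta -> 0 <= C -> t <= s ->
  (forall a tau b, t <= a -> a <= tau -> tau <= b -> b <= s ->
    `|I b - I a - f tau * (g b - g a)| <= C * (b - a) `^ theta) ->
  is_RS_integral f g t s (I s - I t).
Proof.
move=> th1 C0 ts H e e0.
pose A := C * (s - t) + 1.
have A0 : 0 < A by rewrite /A ltr_wpDl// mulr_ge0// subr_ge0.
exists ((e / A) `^ (theta - 1)^-1); first by rewrite powR_gt0// divr_gt0.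
move=> p tau hp; have [pp /eqP lp] := hp; set eta := (_ `^ _) => hmesh.
have etaE : eta `^ (theta - 1) = e / A.
  by rewrite -powRrM mulVf ?subr_eq0 ?gt_eqF// powRr1// divr_ge0// ltW.
set x := nth t (t :: p).
have xE : x (size p) = s by rewrite /x -last_nth.
have -> : I s - I t = \sum_(i < size p) (I (x i.+1) - I (x i)).
  rewrite -(big_mkord xpredT (fun i => I (x i.+1) - I (x i))) telescope_sumr//.
  by rewrite xE.
have xle i : (i < size p)%N -> [/\ t <= x i, x i <= tau i, tau i <= x i.+1 & x i.+1 <= s].
  move=> hi; have [_ h1 h2] := hmesh i hi.
  split=> //; rewrite /x (set_nth_default s) /= ?ltnS// ?(leqW hi)// 1?ltnW//.
    exact: (itv_partition_nth_ge (leqW hi) hp).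
  have := itv_partition_nth_le (hi : i.+1 < (size p).+1)%N hp; exact.
rewrite /RS_sum -sumrB; apply: le_lt_trans (ler_norm_sum _ _ _) _.
apply: (@le_lt_trans _ _ (\sum_(i < size p) C * (x i.+1 - x i) * (e / A))).
  apply: ler_sum => -[i hi] _ /=; have [h1 h2 h3 h4] := xle i hi.
  rewrite -/x distrC; apply: le_trans (H _ _ _ h1 h2 h3 h4) _.
  have d0 : 0 <= x i.+1 - x i by rewrite subr_ge0; exact: le_trans h3.
  rewrite -mulrA ler_wpM2l// -etaE -mulr_powRB1//; last by lra.
  rewrite ler_wpM2l// ge0_ler_powR ?nnegrE ?powR_ge0 ?subr_ge0//; first exact: ltW.
    exact: le_trans h3.
  by have [/ltW] := hmesh i hi.
rewrite -mulr_suml -mulr_sumr.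
have -> : \sum_(i < size p) (x i.+1 - x i) = s - t.
  by rewrite -(big_mkord xpredT (fun i => x i.+1 - x i)) telescope_sumr// xE.
rewrite mulrCA gtr_pMr// ltr_pdivrMr// mul1r /A; lra.
Qed.

(** * Lebesgue integrals of Hoelder functions *)

Lemma hoelder_continuous_within (R : realType) (f : R -> R) (C lam t e : R) :
  0 < lam -> 0 <= C ->
  (forall p q, t <= p <= e -> t <= q <= e -> `|f p - f q| <= C * `|p - q| `^ lam) ->
  {within `[t, e], continuous f}.
Proof.
move=> lam0 C0 hf; apply/subspace_continuousP => x; rewrite /= in_itv/= => hx.
apply/cvgrPdist_le => eps eps0.
pose del := (eps / (C + 1)) `^ lam^-1.
have C1 : 0 < C + 1 by lra.
have del0 : 0 < del by rewrite powR_gt0// divr_gt0.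
have : nbhs x (ball x del) by exact: nbhsx_ballx.
apply: filterS => y; rewrite -ball_normE/= => xy; rewrite in_itv/= => hy.
apply: le_trans (hf x y hx hy) _.
apply: (@le_trans _ _ (C * del `^ lam)).
  by apply: ler_wpM2l => //; apply: ge0_ler_powR; rewrite ?nnegrE ?normr_ge0// ?(ltW lam0)// ltW.
rewrite -powRrM mulVf ?gt_eqF// powRr1; last by rewrite divr_ge0// ltW.
by rewrite mulrA ler_pdivrMr// mulrC ler_wpM2l ?(ltW eps0)//; lra.
Qed.

(** The germ estimate for the drift: on [a, b] the integrand stays within C (b - a)^lam of its value
    at the tag. *)
Lemma Rintegral_germ (R : realType) (f : R -> R) (C lam t e : R) :
  0 < lam -> 0 <= C ->
  (forall p q, t <= p <= e -> t <= q <= e -> `|f p - f q| <= C * `|p - q| `^ lam) ->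
  forall a tau b, t <= a -> a <= tau -> tau <= b -> b <= e ->
  `|\int[@lebesgue_measure R]_(q in `[t, b]) f q -
    \int[@lebesgue_measure R]_(q in `[t, a]) f q - f tau * (b - a)| <=
  C * (b - a) `^ (1 + lam).
Proof.
move=> lam0 C0 hf a tau b ta atau taub be.
have ab : a <= b by exact: le_trans taub.
have int p q : t <= p -> q <= e -> (@lebesgue_measure R).-integrable `[p, q] (EFin \o f).
  move=> tp qe; apply: continuous_compact_integrable; first exact: segment_compact.
  apply: (hoelder_continuous_within lam0 C0) => x y /andP[px xq] /andP[py yq].
  by apply: hf; rewrite (le_trans tp)//= (le_trans _ qe).
have -> : \int[@lebesgue_measure R]_(q in `[t, b]) f q -
    \int[@lebesgue_measure R]_(q in `[t, a]) f q = \int[@lebesgue_measure R]_(q in `[a, b]) f q.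
  rewrite Rintegral_itvB ?bnd_simp//; last exact: int.
  rewrite Rintegral_itv_obnd_cbnd//.
  by apply: integrableS (int a b ta be) => //; apply: subset_itvr; rewrite bnd_simp.
pose M := C * (b - a) `^ lam.
have hM q : a <= q <= b -> `|f q - f tau| <= M.
  by move=> /andP[aq qb]; exact: (hoelder_le (ltW lam0) C0 hf ta be).
have cst r : \int[@lebesgue_measure R]_(q in `[a, b]) r = r * (b - a).
  rewrite Rintegral_cst//= lebesgue_measure_itv/= lte_fin.
  case: ifPn => //=; rewrite -leNgt => ba.
  by have -> : b = a; [apply/eqP; rewrite eq_le ab ba|rewrite subrr].
have icst r : (@lebesgue_measure R).-integrable `[a, b] (EFin \o (fun=> r : R)).
  apply: continuous_compact_integrable; first exact: segment_compact.
  by apply: continuous_subspaceT => x; exact: cvg_cst.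
have h1 : (f tau - M) * (b - a) <= \int[@lebesgue_measure R]_(q in `[a, b]) f q.
  rewrite -cst; apply: le_Rintegral => //; first exact: int.
  by move=> q; rewrite /= in_itv/= => /hM; rewrite ler_norml => /andP[h _]; lra.
have h2 : \int[@lebesgue_measure R]_(q in `[a, b]) f q <= (f tau + M) * (b - a).
  rewrite -cst; apply: le_Rintegral => //; first exact: int.
  by move=> q; rewrite /= in_itv/= => /hM; rewrite ler_norml => /andP[_ h]; lra.
have -> : C * (b - a) `^ (1 + lam) = M * (b - a).
  rewrite powRD; last by apply/implyP => /eqP; lra.
  by rewrite powRr1 ?subr_ge0// /M; ring.
move: h1 h2; rewrite ler_norml mulrBl mulrDl; move: (Rintegral _ _ _) => I h1 h2.
by apply/andP; split; lra.
Qed.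

(** * Gaussian tails *)

Lemma measurable_norm_ge (R : realType) (m r : R) : measurable [set x : R | r <= `|x - m|].
Proof.
rewrite [X in measurable X](_ : _ = setT `&` (fun x : R => `|x - m|) @^-1` `[r, +oo[%classic).
  apply: (_ : measurable_fun setT (fun x : R => `|x - m|)) => //.
  by apply: measurableT_comp => //; apply: measurable_funB.
by rewrite setTI; apply/seteqP; split => x /=; rewrite in_itv/= andbT.
Qed.

(** Doubling the standard deviation halves the peak and leaves exp(-3 (x - m)^2 / (8 s^2)) as the
    quotient of the exponentials, which is at most exp(-r^2 / (4 s^2)). The tail bound then needs no
    integration, since the wider density has total mass 1. *)
Lemma normal_pdf_scale (R : realType) (m s r x : R) : 0 < s -> 0 <= r -> r <= `|x - m| ->
  normal_pdf m s x <= 2 * expR (- (r ^+ 2 / (4 * s ^+ 2))) * normal_pdf m (2 * s) x.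
Proof.
move=> s0 r0 rx; rewrite !normal_pdfE ?gt_eqF ?mulr_gt0// /normal_peak /normal_fun.
have -> : (2 * s) ^+ 2 * pi *+ 2 = 2 ^+ 2 * (s ^+ 2 * pi *+ 2) by ring.
rewrite sqrtrM ?sqr_ge0// sqrtr_sqr ger0_norm//.
set p := Num.ExtraDef.sqrtr _.
have -> : 2 * expR (- (r ^+ 2 / (4 * s ^+ 2))) *
    ((2 * p)^-1 * expR (- (x - m) ^+ 2 / ((2 * s) ^+ 2 *+ 2)))
  = p^-1 * expR (- (r ^+ 2 / (4 * s ^+ 2)) + - (x - m) ^+ 2 / ((2 * s) ^+ 2 *+ 2)).
  by rewrite expRD (invfM 2 p); move: p^-1 (expR _) (expR _) => a b c; field.
rewrite ler_wpM2l ?invr_ge0 ?sqrtr_ge0// ler_expR.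
have rx2 : r ^+ 2 <= (x - m) ^+ 2.
  by rewrite -(real_normK (num_real (x - m))) lerXn2r ?nnegrE.
have -> : - (x - m) ^+ 2 / (s ^+ 2 *+ 2) = - (4 * (x - m) ^+ 2) * (8 * s ^+ 2)^-1.
  by field; rewrite gt_eqF.
have -> : - (r ^+ 2 / (4 * s ^+ 2)) + - (x - m) ^+ 2 / ((2 * s) ^+ 2 *+ 2) =
  - (2 * r ^+ 2 + (x - m) ^+ 2) * (8 * s ^+ 2)^-1.
  by field; rewrite gt_eqF.
rewrite ler_wpM2r//; first by rewrite invr_ge0 mulr_ge0// sqr_ge0.
by have := sqr_ge0 (x - m); lra.
Qed.

Lemma normal_tail (R : realType) (m s r : R) : 0 < s -> 0 <= r ->
  (normal_prob m s [set x | r <= `|x - m|]%R <=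
   (2 * expR (- (r ^+ 2 / (4 * s ^+ 2))))%:E)%E.
Proof.
move=> s0 r0; rewrite /normal_prob.
set A := [set x | _]; have mA : measurable A by exact: measurable_norm_ge.
set c := (2 * _)%R; have c0 : (0 <= c)%R by rewrite mulr_ge0// expR_ge0.
apply: (@le_trans _ _ (\int[lebesgue_measure]_(x in A) (c%:E * (normal_pdf m (2 * s) x)%:E))%E).
  apply: ge0_le_integral => //.
  - by move=> x _; rewrite lee_fin normal_pdf_ge0.
  - by apply/measurable_EFinP; apply: measurable_funTS; exact: measurable_normal_pdf.
  - apply/measurable_EFinP; apply: measurable_funTS; apply: measurable_funM => //.
    exact: measurable_normal_pdf.
  - by move=> x Ax; rewrite -EFinM lee_fin normal_pdf_scale.
rewrite ge0_integralZl//; last 2 first.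
- by apply/measurable_EFinP; apply: measurable_funTS; exact: measurable_normal_pdf.
- by move=> x _; rewrite lee_fin normal_pdf_ge0.
rewrite -[leRHS]mule1; apply: lee_wpmul2l; first by rewrite lee_fin.
exact: (@probability_le1 _ _ _ (normal_prob m (2 * s)) A mA).
Qed.

(** The density is at most 1 / (2 s) because sqrt(2 pi) >= 2, and the interval has length 2 q. *)
Lemma normal_prob_ball_le (R : realType) (m s q : R) : 0 < s -> 0 <= q ->
  (normal_prob m s `[(- q)%R, q]%classic <= (q / s)%:E)%E.
Proof.
move=> s0 q0; rewrite /normal_prob.
apply: (@le_trans _ _ (\int[lebesgue_measure]_(x in `[(- q)%R, q]) ((2 * s)^-1)%:E)%E).
  apply: ge0_le_integral => //.
  - by move=> x _; rewrite lee_fin normal_pdf_ge0.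
  - by apply/measurable_EFinP; apply: measurable_funTS; exact: measurable_normal_pdf.
  - move=> x _; rewrite lee_fin (le_trans (normal_pdf_ub _ _ _))// ?gt_eqF//.
    rewrite /normal_peak lef_pV2 ?posrE ?mulr_gt0//; last first.
      by rewrite sqrtr_gt0 pmulrn_lgt0// mulr_gt0 ?exprn_gt0// pi_gt0.
    rewrite -[leLHS](@ger0_norm _ (2 * s)) ?mulr_ge0// ?(ltW s0)// -sqrtr_sqr ler_sqrt.
      by have := @pi_ge2 R; have := exprn_gt0 2 s0; rewrite -mulr_natr; nra.
    by rewrite mulrn_wge0// mulr_ge0// ?sqr_ge0// ltW// pi_gt0.
rewrite integral_cst//= lebesgue_measure_itv/= lte_fin.
case: ifPn => _; last by rewrite mule0 lee_fin divr_ge0// ltW.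
by rewrite -EFinD -EFinM lee_fin opprK -mulr2n -mulr_natl invfM; lra.
Qed.

Lemma second_moment_chebyshev (disp : measure_display) (Omega : measurableType disp)
    (R : realType) (P : probability Omega R) (X : Omega -> R) (v r : R) :
  measurable_fun setT X -> 0 < r -> (\int[P]_w (X w ^+ 2)%:E <= v%:E)%E ->
  (P [set w | r <= `|X w|]%R <= (v / r ^+ 2)%:E)%E.
Proof.
move=> mX r0 hv; set A := [set w | _].
have mA : measurable A.
  rewrite [A](_ : _ = setT `&` X @^-1` [set x | r <= `|x - 0|]); last first.
    by rewrite setTI; apply/seteqP; split => w; rewrite /A/= subr0.
  by apply: mX => //; exact: measurable_norm_ge.
have mX2 : measurable_fun setT (fun w => (X w ^+ 2)%:E).
  by apply/measurable_EFinP; exact: measurable_funX.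
have h : ((r ^+ 2)%:E * P A <= v%:E)%E.
  apply: le_trans hv; rewrite -integral_cst//.
  apply: (@le_trans _ _ (\int[P]_(w in A) (X w ^+ 2)%:E)%E).
    apply: ge0_le_integral => //.
    - by move=> w _; rewrite lee_fin sqr_ge0.
    - exact: measurable_funTS.
    - move=> w; rewrite /A/= lee_fin => h.
      by rewrite -(real_normK (num_real (X w))) lerXn2r ?nnegrE// ltW.
  apply: ge0_subset_integral => //.
  by move=> w _; rewrite lee_fin sqr_ge0.
rewrite -(fineK (fin_num_measure P A mA)) in h *.
by rewrite lee_fin ler_pdivlMr ?exprn_gt0// mulrC -lee_fin EFinM.
Qed.

(** The exponential series of y dominates its term of degree k + 1. *)
Lemma expRN_le_fact (R : realType) (y : R) (k : nat) : 0 < y ->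
  expR (- y) <= k.+1`!%:R / y ^+ k.+1.
Proof.
move=> y0; rewrite expRN -[leRHS]invrK lef_pV2 ?posrE ?expR_gt0//; last first.
  by rewrite invr_gt0 divr_gt0 ?exprn_gt0// ltr0n fact_gt0.
rewrite invf_div; apply: le_trans (expR_ge1Dxn k (ltW y0)).
by rewrite lerDr.
Qed.

(* Chebyshev's inequality forces the mean and the standard deviation of X to be
   of order sqrt v: otherwise the law of X would give a small mass to
   [- 2 sqrt v, 2 sqrt v]. *)
Lemma gaussian_tail (disp : measure_display) (Omega : measurableType disp)
    (R : realType) (P : probability Omega R) (X : Omega -> R) (v lam : R) :
  gaussian_rv P X -> 0 < v -> (\int[P]_w (X w ^+ 2)%:E <= v%:E)%E ->
  28 * Num.sqrt v <= lam ->
  (P [set w | lam <= `|X w|]%R <= (2 * expR (- (lam ^+ 2 / (144 * v))))%:E)%E.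
Proof.
move=> [mX [m [s [s0 law]]]] v0 hv hlam.
pose q := Num.sqrt v; rewrite -/q in hlam.
have q0 : 0 < q by rewrite sqrtr_gt0.
have q2 : q ^+ 2 = v by rewrite sqr_sqrtr// ltW.
have E2 : (P [set w | 2 * q <= `|X w|]%R <= (1 / 4)%:E)%E.
  apply: le_trans (second_moment_chebyshev mX _ hv) _; first by rewrite mulr_gt0.
  by rewrite lee_fin exprMn q2 -(natrX _ 2 2) invfM mulrCA mulfV ?gt_eqF// mulr1 mul1r.
have XA (r : R) (A : set R) : (forall w, A (X w) <-> r <= `|X w|) -> measurable A ->
    P [set w | r <= `|X w|]%R = if s == 0 then \d_m A else normal_prob m s A.
  by move=> hA mA; rewrite -law//; congr (P _); apply/seteqP; split => w /hA.
have Xnorm (r : R) : P [set w | r <= `|X w|]%R =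
    if s == 0 then \d_m [set x | r <= `|x - 0|]%R
    else normal_prob m s [set x | r <= `|x - 0|]%R.
  by apply: XA; [move=> w /=; rewrite subr0|exact: measurable_norm_ge].
have [s00|sn0] := eqVneq s 0.
  have m2 : `|m| < 2 * q.
    rewrite ltNge; apply/negP => hm; move: E2; rewrite Xnorm s00 eqxx diracE.
    by rewrite mem_set ?lee_fin/= ?subr0//; lra.
  rewrite Xnorm s00 eqxx diracE memNset/= ?subr0; last by apply/negP; rewrite -ltNge; lra.
  by rewrite lee_fin mulr_ge0// expR_ge0.
have sgt0 : 0 < s by rewrite lt_neqAle eq_sym sn0.
(* By Chebyshev the ball of radius 2 q carries at least 3/4 of the mass, hence so does every
   measurable set that contains it. *)
have P34 (A : set R) : measurable A -> (forall x, `|x| < 2 * q -> A x) ->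
    ((3 / 4)%:E <= normal_prob m s A)%E.
  move=> mA hA.
  have mB := measurable_norm_ge 0 (2 * q).
  have : (1 <= normal_prob m s A + normal_prob m s [set x | 2 * q <= `|x - 0|]%R)%E.
    rewrite -(@probability_setT _ _ _ (normal_prob m s)).
    apply: le_trans (@measureU2 _ _ _ (normal_prob m s) _ _ mA mB).
    apply: le_measure; rewrite ?inE//; first exact: measurableU.
    move=> x _; have [h|h] := ltP `|x| (2 * q); first by left; exact: hA.
    by right; rewrite /= subr0.
  move: E2; rewrite Xnorm (negbTE sn0).
  have fA : normal_prob m s A \is a fin_num by exact: (@fin_num_measure _ _ _ (normal_prob m s)).
  have fB : normal_prob m s [set x | 2 * q <= `|x - 0|]%R \is a fin_num.
    exact: (@fin_num_measure _ _ _ (normal_prob m s)).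
  by rewrite -(fineK fA) -(fineK fB) -EFinD !lee_fin; lra.
(* A larger [s] spreads the law too thinly: 3/4 <= 2 q / s forces s <= 8 q / 3. *)
have sq : s <= 3 * q.
  have : ((3 / 4)%:E <= (2 * q / s)%:E)%E.
    apply: le_trans (normal_prob_ball_le m sgt0 _); last by lra.
    apply: P34 => // x hx; rewrite /= in_itv/=.
    by move: hx; rewrite ltr_norml => /andP[? ?]; apply/andP; split; exact: ltW.
  by rewrite lee_fin ler_pdivlMr//; lra.
(* Otherwise the ball of radius 2 q lies at distance at least 12 q >= 4 s from the mean, where the
   mass is at most 2 exp(-4) <= 2/5 < 3/4. *)
have mq : `|m| <= 14 * q.
  rewrite leNgt; apply/negP => hm.
  have : ((3 / 4)%:E <= (2 * expR (- ((4 * s) ^+ 2 / (4 * s ^+ 2))))%:E)%E.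
    apply: le_trans (normal_tail m sgt0 _); last by lra.
    apply: P34; first exact: measurable_norm_ge.
    by move=> x hx /=; have := ler_normB x (x - m); rewrite opprB addrC subrK; lra.
  have -> : (4 * s) ^+ 2 / (4 * s ^+ 2) = 4 by field; rewrite gt_eqF.
  rewrite lee_fin expRN; have := @expR_ge1Dx R 4; move: (expR 4) => y hy.
  by rewrite ler_pdivlMr; lra.
rewrite Xnorm (negbTE sn0).
(* Since lam >= 28 q >= 2 |m|, a value beyond lam is at least lam / 2 away from the mean. With s^2
   <= 9 v this turns [normal_tail] into the constant 144 = 16 * 9. *)
apply: (@le_trans _ _ (normal_prob m s [set x | lam / 2 <= `|x - m|]%R)).
  apply: le_measure; rewrite ?inE//; [exact: measurable_norm_ge|exact: measurable_norm_ge|].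
  by move=> x /=; rewrite subr0 => hx; have := ler_normD (x - m) m; rewrite subrK; lra.
apply: le_trans (normal_tail m sgt0 _) _; first by lra.
rewrite lee_fin ler_wpM2l// ler_expR lerN2 ler_pdivrMr ?mulr_gt0//.
rewrite mulrAC ler_pdivlMr; last by rewrite mulr_gt0 ?exprn_gt0.
rewrite exprMn mulrAC -q2.
have s2 : s ^+ 2 <= 9 * q ^+ 2.
  have -> : 9 * q ^+ 2 = (3 * q) ^+ 2 by ring.
  by rewrite lerXn2r ?nnegrE// ?(ltW sgt0)//; lra.
have := sqr_ge0 lam; nra.
Qed.

(** A power of v / lam^2 replaces the exponential, with a constant common to all Gaussian variables.
    Below the threshold lam = 28 sqrt v of [gaussian_tail] the term with 784 = 28^2 already exceeds
    1. *)
Lemma gaussian_tail_power (disp : measure_display) (Omega : measurableType disp)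
    (R : realType) (P : probability Omega R) (k : nat) :
  exists2 C : R, 0 < C & forall (X : Omega -> R) (v lam : R),
  gaussian_rv P X -> 0 < v -> (\int[P]_w (X w ^+ 2)%:E <= v%:E)%E -> 0 < lam ->
  (P [set w | lam <= `|X w|]%R <= (C * (v / lam ^+ 2) ^+ k.+1)%:E)%E.
Proof.
pose A : R := 784; pose B : R := 144.
have A0 : 0 < A by rewrite ltr0n.
have B0 : 0 < B by rewrite ltr0n.
have c0 : 0 <= 2 * (k.+1)`!%:R :> R by rewrite mulr_ge0.
exists (A ^+ k.+1 + 2 * (k.+1)`!%:R * B ^+ k.+1).
  by rewrite ltr_pwDl ?exprn_gt0// mulr_ge0// exprn_ge0// ltW.
move=> X v lam gX v0 hv lam0.
have vl0 : 0 < v / lam ^+ 2 by rewrite divr_gt0// exprn_gt0.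
set z := v / lam ^+ 2 in vl0 *.
have hA : 0 <= A ^+ k.+1 * z ^+ k.+1.
  by rewrite mulr_ge0// exprn_ge0// ltW.
have hB : 0 <= 2 * (k.+1)`!%:R * B ^+ k.+1 * z ^+ k.+1.
  by rewrite !mulr_ge0// exprn_ge0// ltW.
rewrite mulrDl.
have [hl|hl] := leP (28 * Num.sqrt v) lam.
  apply: le_trans (gaussian_tail gX v0 hv hl) _.
  rewrite -/B lee_fin -[leLHS]add0r lerD//.
  rewrite -(mulrA 2) -(mulrA 2) ler_wpM2l//.
  have y0 : 0 < lam ^+ 2 / (B * v) by rewrite divr_gt0// ?exprn_gt0// mulr_gt0.
  apply: le_trans (expRN_le_fact k y0) _.
  by rewrite -mulrA -exprMn -exprVn invf_div /z mulrA.
apply: (@le_trans _ _ 1%E).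
  apply: probability_le1.
  rewrite [X in measurable X](_ : _ = setT `&` X @^-1` [set x | lam <= `|x - 0|]); last first.
    by rewrite setTI; apply/seteqP; split => w /=; rewrite subr0.
  by case: gX => mX _; apply: mX => //; exact: measurable_norm_ge.
rewrite lee_fin -[leLHS]addr0 lerD//.
rewrite -exprMn exprn_ege1// /z mulrA ler_pdivlMr ?exprn_gt0// mul1r.
have := sqr_sqrtr (ltW v0) => <-.
have -> : A * Num.sqrt v ^+ 2 = (28 * Num.sqrt v) ^+ 2 by rewrite /A; ring.
by rewrite lerXn2r ?nnegrE ?(ltW hl)// ?(ltW lam0)// mulr_ge0.
Qed.

(** * Dyadic chaining *)

Lemma half_expn_lt (R : realType) (y : R) : 0 < y -> exists n : nat, (2^-1 : R) ^+ n < y.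
Proof.
move=> y0; exists (Num.trunc y^-1).+1.
rewrite exprVn invf_plt ?posrE ?exprn_gt0//.
by apply: lt_trans (truncnS_gt _) _; rewrite -natrX ltr_nat ltn_expl.
Qed.

Lemma dyadic_scale (R : realType) (N : nat) (y : R) : 0 < y -> y < 2^-1 ^+ N ->
  exists2 n : nat, (N <= n)%N & (2^-1 : R) ^+ n.+1 <= y /\ y < 2^-1 ^+ n.
Proof.
move=> y0 yN.
have ex : exists m : nat, (2^-1 : R) ^+ m <= y.
  by have [m /ltW] := half_expn_lt y0; exists m.
case: (ex_minnP ex) => m hm hmin.
have Nm : (N < m)%N.
  rewrite ltnNge; apply/negP => mN.
  have : (2^-1 : R) ^+ N <= 2^-1 ^+ m by apply: ler_wiXn2l; rewrite ?invr_ge0 ?invf_le1 ?ler1n.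
  lra.
exists m.-1; first by rewrite -ltnS prednK// (leq_ltn_trans _ Nm).
rewrite prednK ?(leq_ltn_trans _ Nm)//; split => //.
rewrite ltNge; apply/negP => /hmin; lia.
Qed.

Definition dyadic_floor (R : realType) (T : R) (n : nat) (p : R) : nat :=
  Num.trunc (p * 2 ^+ n / T).

Definition dyadic_point (R : realType) (T : R) (n k : nat) : R :=
  T * k%:R * 2^-1 ^+ n.

Lemma dyadic_floor_itv (R : realType) (T p : R) (n : nat) : 0 < T -> 0 <= p ->
  (dyadic_floor T n p)%:R <= p * 2 ^+ n / T < (dyadic_floor T n p).+1%:R.
Proof.
move=> T0 p0; rewrite /dyadic_floor truncn_le ?truncnS_gt ?andbT//.
by rewrite divr_ge0 ?mulr_ge0 ?exprn_ge0// ltW.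
Qed.

Lemma dyadic_floor_le (R : realType) (T p : R) (n : nat) : 0 < T -> 0 <= p -> p <= T ->
  (dyadic_floor T n p <= 2 ^ n)%N.
Proof.
move=> T0 p0 pT; have /andP[h _] := dyadic_floor_itv n T0 p0.
rewrite -(ler_nat R) (le_trans h)// ler_pdivrMr// natrX mulrC.
by rewrite ler_wpM2l// exprn_ge0.
Qed.

Lemma dyadic_floorS (R : realType) (T p : R) (n : nat) : 0 < T -> 0 <= p ->
  (dyadic_floor T n.+1 p = (dyadic_floor T n p).*2 \/
   dyadic_floor T n.+1 p = (dyadic_floor T n p).*2.+1)%N.
Proof.
move=> T0 p0; have /andP[h1 h2] := dyadic_floor_itv n T0 p0.
have /andP[h3 h4] := dyadic_floor_itv n.+1 T0 p0.
move: h1 h2 h3 h4; rewrite exprS.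
have -> : p * (2 * 2 ^+ n) / T = 2 * (p * 2 ^+ n / T) by field; rewrite gt_eqF.
move: (_ / T) (dyadic_floor T n p) (dyadic_floor T n.+1 p) => y a b h1 h2 h3 h4.
have h5 : (b < a.*2.+2)%N.
  by rewrite -(ltr_nat R) -doubleS -muln2 natrM; lra.
have h6 : (a.*2 < b.+1)%N.
  by rewrite -(ltr_nat R) -muln2 natrM; lra.
lia.
Qed.

Lemma dyadic_point_double (R : realType) (T : R) (n k : nat) :
  dyadic_point T n.+1 k.*2 = dyadic_point T n k.
Proof. by rewrite /dyadic_point exprS -muln2 natrM; field. Qed.

Lemma dyadic_point_floor (R : realType) (T p : R) (n : nat) : 0 < T -> 0 <= p ->
  0 <= dyadic_point T n (dyadic_floor T n p) <= p /\
  p - dyadic_point T n (dyadic_floor T n p) <= T * 2^-1 ^+ n.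
Proof.
move=> T0 p0; have /andP[] := dyadic_floor_itv n T0 p0.
rewrite /dyadic_point; move: (dyadic_floor T n p) => k.
rewrite -[k.+1]addn1 natrD => h1 h2.
have e0 : 0 < (2^-1 : R) ^+ n by rewrite exprn_gt0// invr_gt0.
have pE : p = (p * 2 ^+ n / T) * T * 2^-1 ^+ n.
  by rewrite exprVn; field; rewrite gt_eqF//= gt_eqF// exprn_gt0.
move: pE h1 h2; move: (_ / T) => y -> h1 h2.
rewrite mulr_ge0 ?mulr_ge0 ?(ltW T0) ?(ltW e0)//=.
rewrite (mulrC T) ler_wpM2r ?(ltW e0)// ?ler_wpM2r ?(ltW T0)//; split => //.
by rewrite -mulrBl -mulrBl ler_wpM2r ?(ltW e0)// -[leRHS]mul1r ler_wpM2r ?(ltW T0)//; lra.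
Qed.

(* The value at p is compared to the values at the dyadic points below p. *)
Lemma dyadic_hoelder (R : realType) (g : R -> R) (T gam : R) (N : nat) :
  0 < T -> 0 < gam -> {within `[0, +oo[, continuous g} ->
  (forall n k, (N <= n)%N -> (k < 2 ^ n)%N ->
    `|g (dyadic_point T n k.+1) - g (dyadic_point T n k)| <= (2^-1 ^+ n) `^ gam) ->
  exists C eta : R, [/\ 0 <= C, 0 < eta & forall p q, 0 <= p <= T -> 0 <= q <= T ->
    `|p - q| < eta -> `|g p - g q| <= C * `|p - q| `^ gam].
Proof.
move=> T0 gam0 cg hg.
pose r : R := 2^-1 `^ gam.
have r0 : 0 < r by rewrite powR_gt0.
have r1 : r < 1.
  have e1 : 1 `^ gam = 1 :> R by rewrite powR1.
  by rewrite -[ltRHS]e1 gt0_ltr_powR ?nnegrE ?invf_lt1 ?ltr1n ?invr_ge0.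
have xE n : ((2^-1 : R) ^+ n) `^ gam = r ^+ n.
  by rewrite -powR_mulrn ?invr_ge0// powRAC powR_mulrn// ltW.
(* [A * r ^+ n] is the sum of the geometric series from r^(n+1) on, the total of all dyadic steps
   finer than level n. *)
pose A := r / (1 - r).
have A0 : 0 <= A by rewrite divr_ge0 ?subr_ge0// ltW.
have AE : A * (1 - r) = r by rewrite /A mulfVK// subr_eq0 gt_eqF.
pose f n p := dyadic_point T n (dyadic_floor T n p).
have chain n m p : 0 <= p <= T -> (N <= n)%N ->
    `|g (f (n + m)%N p) - g (f n p)| <= A * (r ^+ n - r ^+ (n + m)).
  move=> /andP[p0 pT] Nn; elim: m => [|m IHm]; first by rewrite addn0 !subrr normr0 mulr0.
  (* Refining by one level moves the dyadic point below p by nothing or by a single step of the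
     finer grid. *)
  have step : `|g (f (n + m).+1 p) - g (f (n + m)%N p)| <= r ^+ (n + m).+1.
    rewrite /f; have := dyadic_floor_le (n + m).+1 T0 p0 pT.
    have [->|->] := dyadic_floorS (n + m) T0 p0.
      by rewrite dyadic_point_double subrr normr0 exprn_ge0// ltW.
    move=> hk; rewrite -(dyadic_point_double T (n + m)) -xE; apply: hg => //.
    by rewrite leqW// (leq_trans Nn)// leq_addr.
  rewrite addnS; apply: le_trans (ler_distD (g (f (n + m)%N p)) _ _) _.
  apply: le_trans (lerD step IHm) _.
  have E : r ^+ (n + m).+1 = A * (1 - r) * r ^+ (n + m) by rewrite AE exprS.
  by rewrite [in leLHS]E exprS le_eqVlt; apply/orP; left; apply/eqP; ring.
have lim p : 0 <= p <= T -> f n p @[n --> \oo] --> p.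
  move=> /andP[p0 pT]; apply/cvgrPdist_lt => e e0.
  have [m hm] := half_expn_lt (divr_gt0 e0 T0).
  exists m => // n /= mn; have [/andP[h1 h2] h3] := dyadic_point_floor n T0 p0.
  rewrite ger0_norm ?subr_ge0//; apply: le_lt_trans h3 _.
  rewrite mulrC -ltr_pdivlMr//; apply: le_lt_trans hm.
  by apply: ler_wiXn2l; rewrite ?invr_ge0 ?invf_le1 ?ler1n.
have limg p : 0 <= p <= T -> g (f n p) @[n --> \oo] --> g p.
  move=> hp B Bp.
  have p0 : `[0, +oo[%classic p by case/andP: hp => p0 _; rewrite /= in_itv/= p0.
  have wB : within `[0, +oo[%classic (nbhs p) (g @^-1` B).
    by rewrite nbhs_subspace_in//; exact: (cg p B Bp).
  have := lim p hp _ wB; rewrite /nbhs /=; apply: filterS => n; apply.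
  case/andP: hp => p00 _; have [/andP[h _] _] := dyadic_point_floor n T0 p00.
  by rewrite /= in_itv/= h.
have tail n p : 0 <= p <= T -> (N <= n)%N -> `|g p - g (f n p)| <= A * r ^+ n.
  move=> hp Nn.
  have : `|g (f m p) - g (f n p)| @[m --> \oo] --> `|g p - g (f n p)|.
    by apply: cvg_norm; apply: cvgB; [exact: limg|exact: cvg_cst].
  move=> L; rewrite -(cvg_lim _ L)//; apply: limr_le; first by apply/cvg_ex; eexists; exact: L.
  exists n => // m /= nm; rewrite -(subnKC nm); apply: le_trans (chain n (m - n)%N p hp Nn) _.
  by rewrite ler_wpM2l// gerBl exprn_ge0// ltW.
have local p q : 0 <= p <= T -> 0 <= q <= T -> p < q -> q - p < T * 2^-1 ^+ N ->
    `|g p - g q| <= (2 * A + 1) * (2 / T) `^ gam * (q - p) `^ gam.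
  move=> hp hq pq pqN.
  have /andP[p0 pT] := hp; have /andP[q0 qT] := hq.
  have d0 : 0 < (q - p) / T by rewrite divr_gt0// subr_gt0.
  have d1 : (q - p) / T < 2^-1 ^+ N by rewrite ltr_pdivrMr// mulrC.
  have [n Nn [dn1 dn2]] := dyadic_scale d0 d1.
  (* At the level n that matches the size of q - p, the dyadic points below p and q coincide or are
     neighbours. *)
  have mid : `|g (f n p) - g (f n q)| <= r ^+ n.
    have /andP[h1 h2] := dyadic_floor_itv n T0 p0.
    have /andP[h3 h4] := dyadic_floor_itv n T0 q0.
    have hlt : q * 2 ^+ n / T < p * 2 ^+ n / T + 1.
      rewrite -ltrBlDl -mulrBl -mulrBl mulrAC.
      by rewrite -ltr_pdivlMr ?exprn_gt0// div1r -exprVn.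
    have hle : p * 2 ^+ n / T <= q * 2 ^+ n / T.
      by rewrite ler_pM2r ?invr_gt0// ler_pM2r ?exprn_gt0// ltW.
    have := dyadic_floor_le n T0 q0 qT; rewrite /f.
    move: h1 h2 h3 h4 hlt hle.
    move: (dyadic_floor T n p) (dyadic_floor T n q) (p * _ / T) (q * _ / T) => a b y z.
    move=> h1 h2 h3 h4 hlt hle hb.
    have l1 : (a < b.+1)%N by rewrite -(ltr_nat R); lra.
    have l2 : (b < a.+2)%N by rewrite -(ltr_nat R) -[a.+2]addn1 natrD; lra.
    have /orP[/eqP ->|/eqP ba] : (b == a) || (b == a.+1).
    - by move: l2; rewrite ltnS leq_eqVlt ltnS => /orP[->|h]; rewrite ?orbT// eqn_leq h -ltnS l1.
    - by rewrite subrr normr0 exprn_ge0// ltW.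
    - by rewrite ba in hb *; rewrite distrC -xE; apply: hg.
  have tot : `|g p - g q| <= (2 * A + 1) * r ^+ n.
    apply: le_trans (ler_distD (g (f n p)) _ _) _.
    apply: le_trans (lerD (tail n p hp Nn) (ler_distD (g (f n q)) _ _)) _.
    rewrite (distrC _ (g q)).
    apply: le_trans (lerD (lexx _) (lerD mid (tail n q hq Nn))) _.
    by rewrite le_eqVlt; apply/orP; left; apply/eqP; ring.
  apply: le_trans tot _; rewrite -mulrA ler_wpM2l//; first lra.
  have T2 : 0 <= 2 / T by rewrite divr_ge0// ltW.
  rewrite -powRM//; last by rewrite subr_ge0 ltW.
  rewrite -xE ge0_ler_powR ?nnegrE ?exprn_ge0 ?invr_ge0//; first exact: ltW.
    by rewrite mulr_ge0// subr_ge0 ltW.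
  by move: dn1; rewrite exprS mulrAC -mulrA; move: (2^-1 ^+ n) (_ / T) => u y; lra.
exists ((2 * A + 1) * (2 / T) `^ gam), (T * 2^-1 ^+ N); split.
- by rewrite mulr_ge0 ?powR_ge0//; lra.
- by rewrite mulr_gt0// exprn_gt0// invr_gt0.
move=> p q hp hq; have [pq|qp|->] := ltgtP p q.
- by rewrite (distrC p) => h; rewrite (gtr0_norm (_ : 0 < q - p)) ?subr_gt0// in h *; exact: local.
- by move=> h; rewrite (distrC (g p)) (gtr0_norm (_ : 0 < p - q)) ?subr_gt0// in h *; exact: local.
- by rewrite !subrr normr0 => _; rewrite mulr_ge0 ?powR_ge0// mulr_ge0 ?powR_ge0//; lra.
Qed.

(** * Hoelder continuity of fractional Brownian motion *)

Lemma fbm_measurable (disp : measure_display) (Omega : measurableType disp)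
    (R : realType) (P : probability Omega R) (H : R) (B : R -> Omega -> R) (t : R) :
  fractional_brownian_motion P H B -> 0 <= t -> measurable_fun setT (B t).
Proof.
move=> [hG _ _ _] t0; have [+ _] := hG 1%N (fun=> 1) (fun=> t) (fun=> t0).
by under eq_fun do rewrite big_ord1 mul1r.
Qed.

Lemma fbm_increment_gaussian (disp : measure_display) (Omega : measurableType disp)
    (R : realType) (P : probability Omega R) (H : R) (B : R -> Omega -> R) (s t : R) :
  fractional_brownian_motion P H B -> 0 <= s -> 0 <= t ->
  gaussian_rv P (fun w => B t w - B s w).
Proof.
move=> [hG _ _ _] s0 t0.
have := hG 2%N (fun i => if i == ord0 then 1 else -1) (fun i => if i == ord0 then t else s).
have -> : (fun w => \sum_(i < 2) (if i == ord0 then 1 else -1) * B (if i == ord0 then t else s) w) =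
    (fun w => B t w - B s w).
  by apply/funext => w; rewrite big_ord_recl big_ord1/= mul1r mulN1r.
by apply=> i; case: ifP.
Qed.

(** The square is expanded under the expectation; the cross term is integrable because |B_s B_t| <=
    B_s^2 + B_t^2, whose expectations the covariance formula shows to be finite. *)
Lemma fbm_increment_moment (disp : measure_display) (Omega : measurableType disp)
    (R : realType) (P : probability Omega R) (H : R) (B : R -> Omega -> R) (s t : R) :
  fractional_brownian_motion P H B -> 0 < H -> 0 <= s -> 0 <= t ->
  (\int[P]_w ((B t w - B s w) ^+ 2)%:E = (`|t - s| `^ (2 * H))%:E)%E.
Proof.
move=> hB H0 s0 t0.
have mB r : 0 <= r -> measurable_fun setT (B r) by move=> r0; exact: fbm_measurable hB r0.
have mBB p q : 0 <= p -> 0 <= q -> measurable_fun setT (fun w => (B p w * B q w)%:E).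
  by move=> p0 q0; apply/measurable_EFinP; apply: measurable_funM; exact: mB.
have cov p q : 0 <= p -> 0 <= q -> (\int[P]_w (B p w * B q w)%:E =
    ((p `^ (2 * H) + q `^ (2 * H) - `|q - p| `^ (2 * H)) / 2)%:E)%E.
  by move=> p0 q0; rewrite -(fbm_cov hB)// unlock.
have i2 p : 0 <= p -> P.-integrable setT (fun w => (B p w * B p w)%:E).
  move=> p0; apply/integrableP; split; first exact: mBB.
  under eq_integral do rewrite gee0_abs ?lee_fin -?expr2 ?sqr_ge0// expr2.
  by rewrite cov// ltry.
have ist : P.-integrable setT (fun w => (B s w * B t w)%:E).
  apply: (le_integrable measurableT _ _ (integrableD measurableT (i2 s s0) (i2 t t0))).
    exact: mBB.
  move=> w _; rewrite -EFinD !abse_EFin lee_fin (@ger0_norm _ (_ + _)); last first.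
    by rewrite -!expr2 addr_ge0 ?sqr_ge0.
  rewrite ler_norml; apply/andP; split.
    have := sqr_ge0 (B s w + B t w); have := sqr_ge0 (B s w).
    by have := sqr_ge0 (B t w); rewrite !expr2; nra.
  have := sqr_ge0 (B s w - B t w); have := sqr_ge0 (B s w).
  by have := sqr_ge0 (B t w); rewrite !expr2; nra.
have E w : (((B t w - B s w) ^+ 2)%:E =
    ((B t w * B t w)%:E + (B s w * B s w)%:E) - (2%R%:E * (B s w * B t w)%:E))%E.
  have -> : (B t w - B s w) ^+ 2 = (B t w * B t w + B s w * B s w) - 2 * (B s w * B t w) by ring.
  by rewrite EFinB EFinD EFinM.
under eq_integral do rewrite E.
rewrite integralB//; last 2 first.
- by apply: integrableD => //; exact: i2.
- exact: integrableZl.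
rewrite integralD//; [|exact: i2|exact: i2].
rewrite integralZl// !cov// !subrr normr0 powR0 ?mulf_neq0 ?gt_eqF//.
set a := (t `^ _ + _ - 0) / 2; set b := (s `^ _ + _ - 0) / 2; set c := (_ / 2).
have -> : `|t - s| `^ (2 * H) = (a + b) - 2 * c by rewrite /a /b /c; field.
by rewrite EFinB EFinD EFinM.
Qed.

(** Borel-Cantelli: an increment of level n has variance (T 2^-n)^(2 H), far below the square of the
    threshold 2^(-n gam), and a sufficiently high power of the quotient beats the number 2^n of
    increments. *)
Lemma fbm_dyadic_increments (disp : measure_display) (Omega : measurableType disp)
    (R : realType) (P : probability Omega R) (H : R) (B : R -> Omega -> R) (T gam : R) :
  fractional_brownian_motion P H B -> 0 < H -> gam < H -> 0 < T ->
  {ae P, forall w, exists N : nat, forall n k, (N <= n)%N -> (k < 2 ^ n)%N ->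
    `|B (dyadic_point T n k.+1) w - B (dyadic_point T n k) w| <= (2^-1 ^+ n) `^ gam}.
Proof.
move=> hB H0 gH T0.
pose F n := \big[setU/set0]_(k < 2 ^ n)
  [set w | (2^-1 ^+ n) `^ gam <= `|B (dyadic_point T n k.+1) w - B (dyadic_point T n k) w| ].
have d0 n k : 0 <= dyadic_point T n k.
  by rewrite /dyadic_point !mulr_ge0 ?exprn_ge0 ?invr_ge0 ?(ltW T0).
have mE n k : measurable [set w | (2^-1 ^+ n) `^ gam <=
    `|B (dyadic_point T n k.+1) w - B (dyadic_point T n k) w|].
  pose X w := B (dyadic_point T n k.+1) w - B (dyadic_point T n k) w.
  rewrite [X in measurable X](_ : _ = setT `&` X @^-1` [set x | (2^-1 ^+ n) `^ gam <= `|x - 0|]).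
    apply: (_ : measurable_fun setT X) => //; last exact: measurable_norm_ge.
    by apply: measurable_funB; apply: fbm_measurable hB _.
  by rewrite setTI; apply/seteqP; split => w; rewrite /X/= subr0.
have mF n : measurable (F n) by apply: bigsetU_measurable => k _; exact: mE.
(* With 2 (H - gam) (K + 1) >= 2 each increment of level n is large with probability at most A 4^-n,
   hence some increment of that level is with probability at most A 2^-n. *)
pose K := Num.trunc (H - gam)^-1.
have HK : 2 <= 2 * (H - gam) * K.+1%:R.
  have := truncnS_gt (H - gam)^-1; rewrite -/K invf_plt ?posrE ?subr_gt0// => h.
  have : (K.+1%:R)^-1 * K.+1%:R <= (H - gam) * K.+1%:R by rewrite ler_wpM2r// ltW.
  by rewrite mulVf//; lra.
have [C C0 hC] := gaussian_tail_power P K.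
pose A := C * (T `^ (2 * H)) ^+ K.+1.
have A0 : 0 <= A by rewrite mulr_ge0 ?exprn_ge0 ?powR_ge0// ltW.
have PF n : (P (F n) <= (A * 2^-1 ^+ n)%:E)%E.
  set x := 2^-1 ^+ n.
  have x0 : 0 < x by rewrite exprn_gt0// invr_gt0.
  have x1 : x <= 1 by rewrite exprn_ile1 ?invr_ge0 ?invf_le1 ?ler1n.
  have PE k : (P [set w | x `^ gam <= `|B (dyadic_point T n k.+1) w - B (dyadic_point T n k) w|]%R
      <= (A * x ^+ 2)%:E)%E.
    pose v := (T * x) `^ (2 * H).
    have v0 : 0 < v by rewrite powR_gt0// mulr_gt0.
    have hv :
        (\int[P]_w ((B (dyadic_point T n k.+1) w - B (dyadic_point T n k) w) ^+ 2)%:E <= v%:E)%E.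
      rewrite (fbm_increment_moment hB)// /v.
      have -> : dyadic_point T n k.+1 - dyadic_point T n k = T * x.
        by rewrite /dyadic_point -[k.+1]addn1 natrD -/x; ring.
      by rewrite ger0_norm// mulr_ge0// ltW.
    apply: le_trans (hC _ v (x `^ gam) (fbm_increment_gaussian hB _ _) v0 hv _) _ => //.
      by rewrite powR_gt0.
    rewrite lee_fin /A -mulrA ler_wpM2l ?(ltW C0)//.
    have -> : v / (x `^ gam) ^+ 2 = T `^ (2 * H) * x `^ (2 * (H - gam)).
      rewrite /v powRM ?(ltW T0) ?(ltW x0)// -mulrA -powR_mulrn ?powR_ge0// -powRrM -powRN -powRD.
        by congr (_ * _ `^ _); ring.
      by rewrite (gt_eqF x0) implybT.
    rewrite exprMn ler_wpM2l ?exprn_ge0 ?powR_ge0//.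
    rewrite -!powR_mulrn ?powR_ge0 ?(ltW x0)// -powRrM.
    by apply: ger_powR => //; rewrite x0.
  apply: le_trans (Boole_inequality _ (fun k _ => mE n k)) _.
  apply: (@le_trans _ _ (\sum_(k < 2 ^ n) (A * x ^+ 2)%:E)%E).
    by apply: lee_sum => k _; exact: PE.
  rewrite sumEFin lee_fin sumr_const card_ord -mulrnAr ler_wpM2l//.
  rewrite -mulr_natl natrX mulrA -exprMn mulfV// expr1n; lra.
have S : (\sum_(n <oo) P (F n) < +oo)%E.
  apply: (@le_lt_trans _ _ (\sum_(n <oo) ((2 * A) / (2 ^ (n + 1))%:R)%:E)%E).
    apply: lee_nneseries => // n _; apply: le_trans (PF n) _.
    by rewrite lee_fin addn1 expnS natrM natrX exprVn invfM; lra.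
  by rewrite (cvg_lim _ (@cvg_geometric_eseries_half R (2 * A) 0))// ltry.
have := lim_sup_set_cvg0 mF S.
have mL : measurable (lim_sup_set F).
  by apply: bigcap_measurable => // k _; apply: bigcup_measurable => j _.
move=> /(negligibleP _ mL).2; apply: negligibleS.
move=> w /=; apply: contra_notP => hw.
have : ~ (\bigcap_n \bigcup_(j >= n) F j) w by exact: hw.
rewrite /bigcap/= => /existsNP[N /not_implyP[_ hN]]; exists N => n k Nn kn.
rewrite leNgt; apply/negP => hlt; apply: hN; exists n => //.
by rewrite /F (bigD1 (Ordinal kn))//=; left; exact: ltW.
Qed.

Lemma fbm_hoelder (disp : measure_display) (Omega : measurableType disp)
    (R : realType) (P : probability Omega R) (H : R) (B : R -> Omega -> R) (T gam : R) :
  fractional_brownian_motion P H B -> 0 < gam -> gam < H -> 0 < T ->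
  {ae P, forall w, exists C eta : R, [/\ 0 <= C, 0 < eta &
    forall p q, 0 <= p <= T -> 0 <= q <= T -> `|p - q| < eta ->
    `|B p w - B q w| <= C * `|p - q| `^ gam]}.
Proof.
move=> hB g0 gH T0.
have H0 : 0 < H by exact: lt_trans gH.
apply: filterS2 (fbm_continuous hB) (fbm_dyadic_increments hB H0 gH T0).
by move=> w cw [N hN]; apply: (dyadic_hoelder T0 g0 cw hN).
Qed.

(** * Calculus and measurability in row vectors *)

Lemma mx_coord_le_norm (R : realType) (p q : nat) (A : 'M[R]_(p, q)) i j : `|A i j| <= `|A|.
Proof.
rewrite [leRHS]/Num.norm/= mx_normrE.
exact: (le_bigmax _ (fun k : 'I_p * 'I_q => `|A k.1 k.2|) (i, j)).
Qed.

Lemma mx_norm_le (R : realType) (p q : nat) (A : 'M[R]_(p, q)) (c : R) :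
  0 <= c -> (forall i j, `|A i j| <= c) -> `|A| <= c.
Proof.
move=> c0 h; rewrite [leLHS]/Num.norm/= mx_normrE.
by apply: bigmax_le => // -[i j] _ /=.
Qed.

Lemma mx_norm_le_enorm (R : realType) (p q : nat) (A : 'M[R]_(p, q)) : `|A| <= enorm A.
Proof.
apply: mx_norm_le => [|i j]; first exact: sqrtr_ge0.
rewrite -sqrtr_sqr ler_wsqrtr// (bigD1 i)//= (bigD1 j)//= -addrA lerDl.
by rewrite addr_ge0// ?sumr_ge0// => *; rewrite ?sqr_ge0// sumr_ge0// => *; rewrite sqr_ge0.
Qed.

Lemma enorm_le_mx_norm (R : realType) (p q : nat) (A : 'M[R]_(p, q)) :
  enorm A <= (p * q)%:R * `|A|.
Proof.
rewrite -[leRHS]ger0_norm ?mulr_ge0// -sqrtr_sqr ler_wsqrtr//.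
apply: (@le_trans _ _ (\sum_(i < p) \sum_(j < q) `|A| ^+ 2)).
  apply: ler_sum => i _; apply: ler_sum => j _.
  by rewrite -(real_normK (num_real (A i j))) lerXn2r ?nnegrE// mx_coord_le_norm.
have -> : \sum_(i < p) \sum_(j < q) `|A| ^+ 2 = (p * q)%:R * `|A| ^+ 2.
  under eq_bigr do rewrite sumr_const card_ord.
  by rewrite sumr_const card_ord -mulrnA mulr_natl mulnC.
rewrite [leRHS]exprMn; apply: ler_wpM2r; first exact: sqr_ge0.
by rewrite -natrX ler_nat; case: (p * q)%N => // k; rewrite expnS expn1 leq_pmulr.
Qed.

Lemma mulmx_norm_le (R : realType) (d m : nat) (u : 'rV[R]_d) (A : 'M[R]_(d, m)) :
  `|u *m A| <= d%:R * `|u| * `|A|.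
Proof.
apply: mx_norm_le => [|i j]; first by rewrite !mulr_ge0.
rewrite mxE; apply: le_trans (ler_norm_sum _ _ _) _.
apply: (@le_trans _ _ (\sum_(k < d) `|u| * `|A|)).
  by apply: ler_sum => k _; rewrite normrM ler_pM// mx_coord_le_norm.
by rewrite sumr_const card_ord -mulrA mulr_natl.
Qed.

Lemma diff_coord (R : realType) (p q : nat) (i : 'I_p) (j : 'I_q) (M N : 'M[R]_(p, q)) :
  'd (fun A : 'M[R]_(p, q) => A i j : R) M N = N i j.
Proof.
have @f : {linear 'M[R]_(p, q) -> R}.
  by exists (fun N : 'M[R]_(_, _) => N i j); do 2![eexists]; do ?[constructor];
     rewrite ?mxE// => ? *; rewrite ?mxE//; move=> ?; rewrite !mxE.
rewrite (_ : (fun A : 'M[R]_(p, q) => A i j : R) = f)//.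
by rewrite diff_lin//; exact: coord_continuous.
Qed.

(** The scalar mean value theorem along the segment from [z] to [y]; the intermediate point depends
    on the entry, so the formula holds entry by entry only. *)
Lemma mx_mean_value (R : realType) (d p q : nat) (G : 'rV[R]_d -> 'M[R]_(p, q))
    (y z : 'rV[R]_d) i j : (forall x, differentiable G x) ->
  exists2 c : R, 0 <= c <= 1 &
    G y i j - G z i j = ('d G (z + c *: (y - z)) (y - z)) i j.
Proof.
move=> dG; pose line (c : R) : 'rV[R]_d := z + c *: (y - z).
pose f (c : R) : R := G (line c) i j.
have dline c : is_diff (c : R^o) line (fun h => h *: (y - z)).
  have -> : (fun h : R => h *: (y - z)) = 0 + (fun h : R => h *: (y - z)).
    by apply/funext => h; rewrite /= add0r.
  exact: is_diffD.
have df (c : R) : is_derive c 1 f ('d G (line c) (y - z) i j).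
  have dc := differentiable_coord (G (line c)) i j.
  have dl : differentiable line c by [].
  have dGl : differentiable (G \o line) c by exact: differentiable_comp.
  have dfc : differentiable f c.
    exact: (@differentiable_comp _ _ _ _ (G \o line) (fun A => A i j)).
  split; first exact/derivable1_diffP.
  rewrite deriveE//.
  have -> : f = (fun A : 'M[R]_(p, q) => A i j) \o (G \o line) by [].
  rewrite diff_comp//= diff_comp//=.
  rewrite diff_val scale1r.
  by rewrite diff_coord.
have [|c hc] := @MVT _ f _ 0 1 ltr01 (fun c _ => df c).
  apply: continuous_subspaceT => c; apply: differentiable_continuous.
  by apply/derivable1_diffP; case: (df c).
have -> : f 1 = G y i j by rewrite /f /line scale1r addrC subrK.
have -> : f 0 = G z i j by rewrite /f /line scale0r addr0.
rewrite subr0 mulr1 => ->.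
by exists c => //; move: hc; rewrite in_itv/= => /andP[/ltW -> /ltW ->].
Qed.

Lemma mx_subE (R : realType) (p q : nat) (A B : 'M[R]_(p, q)) i j :
  (A - B) i j = A i j - B i j.
Proof. by rewrite !mxE. Qed.

Lemma segment_norm_le (R : realType) (d : nat) (y z x : 'rV[R]_d) (c : R) :
  0 <= c <= 1 -> `|z + c *: (y - z) - x| <= `|y - x| + `|z - x|.
Proof.
move=> /andP[c0 c1].
have -> : z + c *: (y - z) - x = c *: (y - x) + (1 - c) *: (z - x).
  by apply/rowP => i; rewrite !mxE; ring.
apply: le_trans (ler_normD _ _) _; rewrite !normrZ lerD// ger0_norm ?subr_ge0//.
  by rewrite ler_piMl.
by rewrite ler_piMl// gerBl.
Qed.

Lemma jacobian_lipschitz (R : realType) (d m : nat) (phi : 'rV[R]_d -> 'rV[R]_m) :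
  C2_bounded_second_derivative phi -> exists2 C : R, 0 <= C &
  forall y z, `|jacobian phi y - jacobian phi z| <= C * `|y - z|.
Proof.
move=> [_ d2 _ [C hC]]; exists `|C| => // y z.
apply: mx_norm_le => [|i j]; first by rewrite mulr_ge0.
rewrite mxE [in X in _ + X]mxE.
have [c _ ->] := mx_mean_value y z i j d2.
apply: le_trans (mx_coord_le_norm _ _ _) _; apply: le_trans (hC _ _) _.
by rewrite ler_wpM2r// ler_norm.
Qed.

(** The linearisation is taken at a third point [x], because the tag of a Riemann-Stieltjes sum need
    not be an endpoint of its interval. The mean value point is within |y - x| + |z - x| of it. *)
Lemma C2_taylor (R : realType) (d m : nat) (phi : 'rV[R]_d -> 'rV[R]_m) (C : R) :
  (forall x, differentiable phi x) -> 0 <= C ->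
  (forall y z, `|jacobian phi y - jacobian phi z| <= C * `|y - z|) ->
  forall y z x, `|phi y - phi z - (y - z) *m jacobian phi x| <=
    d%:R * C * (`|y - x| + `|z - x|) * `|y - z|.
Proof.
move=> d1 C0 hC y z x.
apply: mx_norm_le => [|i j].
  by rewrite !mulr_ge0// addr_ge0.
rewrite (ord1 i).
have [c hc E] := mx_mean_value y z 0 j d1.
have -> : (phi y - phi z - (y - z) *m jacobian phi x) 0 j =
    ((y - z) *m (jacobian phi (z + c *: (y - z)) - jacobian phi x)) 0 j.
  rewrite mulmxBr !mx_subE E; congr (_ - _).
  by rewrite mul_rV_lin1.
apply: le_trans (mx_coord_le_norm _ _ _) _; apply: le_trans (mulmx_norm_le _ _) _.
rewrite mulrAC ler_wpM2r// -mulrA ler_wpM2l//; apply: le_trans (hC _ _) _.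
by rewrite ler_wpM2l// segment_norm_le.
Qed.

Lemma measurable_fun_countable_factor (disp : measure_display)
    (Omega : measurableType disp) (R : realType) (T : countType) (D : set Omega)
    (k : Omega -> T) (g : T -> R) :
  (forall z, measurable (D `&` [set w | k w = z])) -> measurable_fun D (g \o k).
Proof.
move=> hk mD Y mY.
rewrite [X in measurable X](_ : _ =
  \bigcup_n (if unpickle n is Some z then
     if `[< Y (g z) >] then D `&` [set w | k w = z] else set0 else set0)); last first.
  apply/seteqP; split => w /=.
    by move=> [Dw Yw]; exists (pickle (k w)) => //; rewrite pickleK asboolT.
  move=> [n _]; case: unpickle => [z|//].
  by case: asboolP => [Yz|//] [Dw kw]; rewrite kw.
apply: bigcup_measurable => n _; case: unpickle => [z|//].
by case: ifP => // _; exact: hk.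
Qed.

Definition grid_round (R : realType) (d : nat) (n : nat) (x : 'rV[R]_d) : {ffun 'I_d -> int} :=
  [ffun i => Num.floor (n.+1%:R * x 0 i)].

Definition grid_point (R : realType) (d : nat) (n : nat) (z : {ffun 'I_d -> int}) : 'rV[R]_d :=
  \row_i ((z i)%:~R / n.+1%:R).

Lemma grid_round_near (R : realType) (d : nat) (n : nat) (x : 'rV[R]_d) :
  `|x - grid_point R n (grid_round n x)| <= n.+1%:R^-1.
Proof.
apply: mx_norm_le => [|i j]; first by rewrite invr_ge0.
rewrite (ord1 i) !mxE ffunE.
have := floor_itv (n.+1%:R * x 0 j); set f := (Num.floor _)%:~R; rewrite intrD -/f.
move=> /andP[h1 h2].
have n0 : 0 < n.+1%:R :> R by [].
have -> : x 0 j - f / n.+1%:R = (n.+1%:R * x 0 j - f) / n.+1%:R.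
  by field; rewrite gt_eqF.
rewrite normrM (@ger0_norm _ (_^-1)) ?invr_ge0// ler_piMl ?invr_ge0//.
by rewrite ger0_norm; lra.
Qed.

(** Measurability of [X] is given by coordinates. Rounding [X] to the grid of mesh 1 / (n + 1)
    yields functions with countably many values, measurable after any map, and by continuity of [G]
    they converge pointwise to [G] of [X]. *)
Lemma measurable_fun_comp_continuous (disp : measure_display)
    (Omega : measurableType disp) (R : realType) (d : nat) (D : set Omega)
    (X : Omega -> 'rV[R]_d) (G : 'rV[R]_d -> R) :
  measurable D -> (forall i, measurable_fun D (fun w => X w 0 i)) ->
  continuous G -> measurable_fun D (fun w => G (X w)).
Proof.
move=> mD mX cG.
apply: (@measurable_fun_cvg _ _ _ D
  (fun n w => ((G \o grid_point R n) \o (fun w => grid_round n (X w))) w)).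
  move=> n; apply: measurable_fun_countable_factor => z.
  rewrite [X in measurable X](_ : _ = D `&` \bigcap_(i in [set: 'I_d])
      (D `&` [set w | (z i)%:~R <= n.+1%:R * X w 0 i < (z i + 1)%:~R])); last first.
    apply/seteqP; split => w /= [Dw].
      by move=> <-; split => // i _ /=; split => //; rewrite ffunE floor_itv.
    move=> h; split => //; apply/ffunP => i; rewrite ffunE; apply/floor_def.
    by have [_] := h i I.
  apply: measurableI => //; apply: fin_bigcap_measurable => // i _.
  rewrite [X in measurable X](_ : _ = D `&` (fun w => n.+1%:R * X w 0 i) @^-1`
      `[(z i)%:~R, (z i + 1)%:~R[%classic); last first.
    by apply/seteqP; split => w /= [Dw]; rewrite in_itv.
  by apply: (measurable_funM (measurable_cst _) (mX i)).
move=> w Dw; apply: (@cvg_comp _ _ _ (fun n => grid_point R n (grid_round n (X w))) G _ (nbhs (X w)));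
  last exact: cG.
apply/cvgrPdist_le => e e0; near=> n.
apply: le_trans (grid_round_near _ _) _.
near: n; exists (Num.trunc e^-1) => // n /= hn.
rewrite invf_ple ?posrE//; apply: le_trans (ltW (truncnS_gt _)) _.
by rewrite ler_nat.
Unshelve. all: by end_near.
Qed.

(** * The change of variables formula *)

Lemma powR_le_exponent (R : realType) (x p q : R) :
  0 <= x <= 1 -> 0 < q -> q <= p -> x `^ p <= x `^ q.
Proof.
move=> /andP[x0 x1] q0 qp; move: x0; rewrite le_eqVlt => /predU1P[<-|x0].
  by rewrite !powR0 ?gt_eqF// (lt_le_trans q0).
by apply: ger_powR => //; rewrite x0.
Qed.

Lemma hoelder_mx_bound (R : realType) (p q : nat) (h : R -> 'M[R]_(p, q)) (c l t e a : R) :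
  e <= t + 1 -> 0 < l -> 0 <= c ->
  (forall x y, t <= x <= e -> t <= y <= e -> `|h x - h y| <= c * `|x - y| `^ l) ->
  t <= a <= e -> `|h a| <= `|h t| + c.
Proof.
move=> et l0 c0 hh ha; have /andP[ta ae] := ha.
have ht : t <= t <= e by rewrite lexx (le_trans ta).
rewrite -[h a](subrK (h t)) addrC.
apply: le_trans (ler_normD _ _) _; rewrite lerD2l; apply: le_trans (hh _ _ ha ht) _.
have e1 : 1 `^ l = 1 :> R by rewrite powR1.
rewrite ler_piMr// -[leRHS]e1.
apply: ge0_ler_powR; rewrite ?nnegrE ?normr_ge0// ?(ltW l0)//.
by rewrite ger0_norm; lra.
Qed.

Lemma hoelder_mulmx (R : realType) (d m : nat) (h : R -> 'rV[R]_d) (A : R -> 'M[R]_(d, m))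
    (c cA l t e : R) :
  e <= t + 1 -> 0 < l -> 0 <= c -> 0 <= cA ->
  (forall x y, t <= x <= e -> t <= y <= e -> `|h x - h y| <= c * `|x - y| `^ l) ->
  (forall x y, t <= x <= e -> t <= y <= e -> `|A x - A y| <= cA * `|x - y| `^ l) ->
  forall x y, t <= x <= e -> t <= y <= e -> `|h x *m A x - h y *m A y| <=
    d%:R * (c * (`|A t| + cA) + (`|h t| + c) * cA) * `|x - y| `^ l.
Proof.
move=> et l0 c0 cA0 hh hA x y hx hy.
have -> : h x *m A x - h y *m A y = (h x - h y) *m A x + h y *m (A x - A y).
  by rewrite mulmxBl mulmxBr addrA subrK.
rewrite mulrDr mulrDl; apply: le_trans (ler_normD _ _) _; apply: lerD.
  apply: le_trans (mulmx_norm_le _ _) _.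
  rewrite -!mulrA ler_wpM2l// (mulrC `|_ - _|) mulrCA.
  apply: ler_pM => //; last exact: hh.
  exact: (hoelder_mx_bound et l0 cA0 hA).
apply: le_trans (mulmx_norm_le _ _) _; rewrite -!mulrA ler_wpM2l//.
apply: ler_pM => //; last exact: hA.
exact: (hoelder_mx_bound et l0 c0 hh).
Qed.

(** In the application [f] is u + U, [k] is v + V, [g] a path of B and [J] the given integrals, with
    lf = 1 - alpha and lam = min(beta, 1 - alpha). Length at most 1 makes smaller exponents
    dominate, so that all errors can be measured by the exponent lam + gam. *)
Record young_data (R : realType) (d : nat) (t e : R) (f k J : R -> 'rV[R]_d)
    (g : R -> R) (Cf Ck Cg lf lam gam : R) : Prop := YoungData {
  young_len : e <= t + 1;
  young_exponents : 1 < lam + gam;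
  young_lam_gt0 : 0 < lam;
  young_lam_le : lam <= lf;
  young_lf_le : lf <= gam;
  young_gam_le1 : gam <= 1;
  young_Cf_ge0 : 0 <= Cf;
  young_Ck_ge0 : 0 <= Ck;
  young_Cg_ge0 : 0 <= Cg;
  young_f : forall p q, t <= p <= e -> t <= q <= e -> `|f p - f q| <= Cf * `|p - q| `^ lf;
  young_k : forall p q, t <= p <= e -> t <= q <= e -> `|k p - k q| <= Ck * `|p - q| `^ lam;
  young_g : forall p q, t <= p <= e -> t <= q <= e -> `|g p - g q| <= Cg * `|p - q| `^ gam;
  young_J : forall s i, t <= s <= e -> is_RS_integral (fun q => k q 0 i) g t s (J s 0 i)
}.

Definition young_path (R : realType) (d : nat) (t : R) (x : 'rV[R]_d)
    (f J : R -> 'rV[R]_d) (s : R) : 'rV[R]_d :=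
  x + \row_i (\int[@lebesgue_measure R]_(q in `[t, s]) (f q 0 i)) + J s.

(** The drift and the Young integral each contribute their germ estimate; the order 1 + lf of the
    drift is at least lam + gam, since lam <= lf and gam <= 1. *)
Lemma young_path_germ (R : realType) (d : nat) (t e : R) (x : 'rV[R]_d)
    (f k J : R -> 'rV[R]_d) (g : R -> R) (Cf Ck Cg lf lam gam : R) :
  young_data t e f k J g Cf Ck Cg lf lam gam ->
  exists2 C : R, 0 <= C & forall a tau b, t <= a -> a <= tau -> tau <= b -> b <= e ->
  `|young_path t x f J b - young_path t x f J a - (b - a) *: f tau - (g b - g a) *: k tau|
    <= C * (b - a) `^ (lam + gam).
Proof.
move=> [et th1 lam0 lamlf lfgam gam1 Cf0 Ck0 Cg0 hf hk hg hJ].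
have lf0 : 0 < lf by lra.
have hfi i p q : t <= p <= e -> t <= q <= e -> `|f p 0 i - f q 0 i| <= Cf * `|p - q| `^ lf.
  by move=> hp hq; rewrite -mx_subE; apply: le_trans (mx_coord_le_norm _ _ _) (hf _ _ hp hq).
have hki i p q : t <= p <= e -> t <= q <= e -> `|k p 0 i - k q 0 i| <= Ck * `|p - q| `^ lam.
  by move=> hp hq; rewrite -mx_subE; apply: le_trans (mx_coord_le_norm _ _ _) (hk _ _ hp hq).
have /choice[K hK] : forall i : 'I_d, exists K, 0 <= K /\
    forall a tau b, t <= a -> a <= tau -> tau <= b -> b <= e ->
    `|J b 0 i - J a 0 i - k tau 0 i * (g b - g a)| <= K * (b - a) `^ (lam + gam).
  move=> i; have gam0 : 0 <= gam by lra.
  have [K K0 H] := RS_integral_young th1 (ltW lam0) gam0 Ck0 Cg0 (hki i) hg (fun s => hJ s i).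
  by exists K.
have SK0 : 0 <= \sum_i K i by apply: sumr_ge0 => i _; case: (hK i).
exists (Cf + \sum_i K i); first by rewrite addr_ge0.
move=> a tau b ta atau taub be.
have ab : a <= b by exact: le_trans taub.
have ba1 : 0 <= b - a <= 1 by apply/andP; split; lra.
have p0 : 0 <= (b - a) `^ (lam + gam) by exact: powR_ge0.
apply: mx_norm_le => [|i j]; first by rewrite mulr_ge0// addr_ge0.
rewrite (ord1 i) {i}.
have G := Rintegral_germ lf0 Cf0 (hfi j) ta atau taub be.
have [Kj0 Yj] := hK j; have {}Yj := Yj a tau b ta atau taub be.
have G' : Cf * (b - a) `^ (1 + lf) <= Cf * (b - a) `^ (lam + gam).
  by rewrite ler_wpM2l//; apply: powR_le_exponent => //; lra.
have Kj : K j * (b - a) `^ (lam + gam) <= (\sum_i K i) * (b - a) `^ (lam + gam).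
  rewrite ler_wpM2r// (bigD1 j)//= lerDl; apply: sumr_ge0 => i _.
  by case: (hK i).
rewrite mulrDl; apply: le_trans (lerD (le_trans G G') (le_trans Yj Kj)).
apply: le_trans (ler_normD _ _); rewrite /young_path !mxE.
set Ib := Rintegral _ _ _; set Ia := Rintegral _ _ _.
by rewrite le_eqVlt; apply/orP; left; apply/eqP; congr `|_|; ring.
Qed.

(** On intervals of length at most 1 the increment of [g] is the roughest of the three terms in the
    germ estimate, so the path inherits its exponent. *)
Lemma young_path_hoelder (R : realType) (d : nat) (t e : R) (x : 'rV[R]_d)
    (f k J : R -> 'rV[R]_d) (g : R -> R) (Cf Ck Cg lf lam gam : R) :
  young_data t e f k J g Cf Ck Cg lf lam gam ->
  exists2 C : R, 0 <= C & forall p q, t <= p <= e -> t <= q <= e ->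
  `|young_path t x f J p - young_path t x f J q| <= C * `|p - q| `^ gam.
Proof.
move=> Y; have [et th1 lam0 lamlf lfgam gam1 Cf0 Ck0 Cg0 hf hk hg hJ] := Y.
have lf0 : 0 < lf by lra.
have gam0 : 0 < gam by lra.
have [C C0 HC] := young_path_germ x Y.
have Mf0 : 0 <= `|f t| + Cf by rewrite addr_ge0.
have Mk0 : 0 <= `|k t| + Ck by rewrite addr_ge0.
set X := young_path t x f J in HC *.
pose C' := C + (`|f t| + Cf) + Cg * (`|k t| + Ck).
have C'0 : 0 <= C' by rewrite !addr_ge0// mulr_ge0// addr_ge0.
have step a b : t <= a -> a <= b -> b <= e -> `|X b - X a| <= C' * (b - a) `^ gam.
  move=> ta ab be.
  have ba1 : 0 <= b - a <= 1 by apply/andP; split; lra.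
  have at1 : `|a - t| <= 1 by rewrite ler_norml; apply/andP; split; lra.
  have ha : t <= a <= e by apply/andP; split; lra.
  have hb : t <= b <= e by apply/andP; split; lra.
  have ht : t <= t <= e by apply/andP; split; lra.
  have fa := hoelder_mx_bound et lf0 Cf0 hf ha.
  have ka := hoelder_mx_bound et lam0 Ck0 hk ha.
  have D0 : 0 <= (b - a) `^ gam by exact: powR_ge0.
  have e1 : (b - a) `^ (lam + gam) <= (b - a) `^ gam by apply: powR_le_exponent => //; lra.
  have e2 : (b - a) <= (b - a) `^ gam.
    by rewrite -[leLHS]powRr1 ?(andP ba1).1//; apply: powR_le_exponent.
  have H := HC a a b ta (lexx a) ab be.
  have gb := hg b a hb ha; rewrite (@ger0_norm _ (b - a)) in gb; last by lra.
  have -> : X b - X a = (X b - X a - (b - a) *: f a - (g b - g a) *: k a)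
      + (b - a) *: f a + (g b - g a) *: k a.
    by rewrite [RHS]addrAC !subrK.
  apply: le_trans (ler_normD _ _) _.
  rewrite /C' (mulrDl (C + (`|f t| + Cf))) (mulrDl C); apply: lerD; last first.
    by rewrite normrZ mulrAC; apply: ler_pM.
  apply: le_trans (ler_normD _ _) _; apply: lerD.
    by apply: le_trans H _; rewrite ler_wpM2l.
  rewrite normrZ mulrC (@ger0_norm _ (b - a)) ?(andP ba1).1//.
  by apply: ler_pM; rewrite ?(andP ba1).1.
exists C' => // p q /andP[tp pe] /andP[tq qe].
have [pq|/ltW qp] := leP p q.
  by rewrite distrC (distrC p) (@ger0_norm _ (q - p)) ?subr_ge0//; exact: step.
by rewrite (@ger0_norm _ (p - q)) ?subr_ge0//; exact: step.
Qed.

(** By [RS_integral_of_germ] it suffices that phi(X) minus the drift integral has the germ k phi'(X)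
    dg. Three errors occur: the Taylor remainder of order 2 gam >= lam + gam, the germ error of X
    multiplied by phi'(X), and the germ error of the new drift; they are the three summands of
    [CI]. *)
Lemma young_chain_rule (R : realType) (d m : nat) (phi : 'rV[R]_d -> 'rV[R]_m)
    (t e : R) (x : 'rV[R]_d)
    (f k J : R -> 'rV[R]_d) (g : R -> R) (Cphi Cf Ck Cg lf lam gam : R) :
  (forall y, differentiable phi y) -> 0 <= Cphi ->
  (forall y z, `|jacobian phi y - jacobian phi z| <= Cphi * `|y - z|) ->
  young_data t e f k J g Cf Ck Cg lf lam gam ->
  let X := young_path t x f J in
  forall s j, t <= s <= e ->
  is_RS_integral (fun q => (k q *m jacobian phi (X q)) 0 j) g t s
    (phi (X s) 0 j - phi (X t) 0 j -
     \int[@lebesgue_measure R]_(q in `[t, s]) (f q *m jacobian phi (X q)) 0 j).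
Proof.
move=> d1 Cphi0 hphi Y X s j hs; have [et th1 lam0 lamlf lfgam gam1 Cf0 Ck0 Cg0 hf hk hg hJ] := Y.
have [lf0 gam0 th0] : [/\ 0 < lf, 0 < gam & 0 < lam + gam] by split; lra.
have [thf thg] : lam + gam <= 1 + lf /\ lam + gam <= gam + gam by split; lra.
have /andP[ts se] := hs.
have len a b : t <= a -> a <= b -> b <= e -> 0 <= b - a <= 1.
  by move=> ta ab be; apply/andP; split; lra.
have [C C0 HC] := young_path_germ x Y.
have [CX CX0 HX] := young_path_hoelder x Y.
rewrite -/X in HC HX.
pose A q := jacobian phi (X q).
have hA p q : t <= p <= e -> t <= q <= e -> `|A p - A q| <= Cphi * CX * `|p - q| `^ lf.
  move=> hp hq; apply: le_trans (hphi _ _) _; rewrite -mulrA ler_wpM2l//.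
  apply: le_trans (HX _ _ hp hq) _; rewrite ler_wpM2l//.
  apply: powR_le_exponent => //; rewrite normr_ge0/=.
  move: hp hq => /andP[tp pe] /andP[tq qe]; have [pq|/ltW qp] := leP p q.
    by rewrite distrC ger0_norm ?subr_ge0//; have /andP[] := len p q tp pq qe.
  by rewrite ger0_norm ?subr_ge0//; have /andP[] := len q p tq qp pe.
have CA0 : 0 <= Cphi * CX by rewrite mulr_ge0.
have hfA := hoelder_mulmx et lf0 Cf0 CA0 hf hA.
set CF := (_%:R * _) in hfA.
have CF0 : 0 <= CF.
  by rewrite /CF mulr_ge0// addr_ge0// mulr_ge0// addr_ge0.
have hfAj p q : t <= p <= e -> t <= q <= e ->
    `|(f p *m A p) 0 j - (f q *m A q) 0 j| <= CF * `|p - q| `^ lf.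
  by move=> hp hq; rewrite -mx_subE; apply: le_trans (mx_coord_le_norm _ _ _) (hfA _ _ hp hq).
pose MA := `|A t| + Cphi * CX.
pose CI := 2 * d%:R * Cphi * CX * CX + d%:R * C * MA + CF.
have MA0 : 0 <= MA by rewrite addr_ge0.
have CI0 : 0 <= CI by rewrite /CI !addr_ge0// !mulr_ge0.
pose I r := phi (X r) 0 j - \int[@lebesgue_measure R]_(q in `[t, r]) (f q *m A q) 0 j.
have -> : phi (X s) 0 j - phi (X t) 0 j -
     \int[@lebesgue_measure R]_(q in `[t, s]) (f q *m jacobian phi (X q)) 0 j = I s - I t.
  by rewrite /I set_itv1 Rintegral_set1 subr0 addrAC.
apply: (RS_integral_of_germ th1 CI0 ts) => a tau b ta atau taub bs.
have be : b <= e by exact: le_trans se.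
have ab : a <= b by exact: le_trans taub.
have ba1 := len a b ta ab be.
have htau : t <= tau <= e by rewrite (le_trans ta)//= (le_trans taub).
have Aj := hoelder_mx_bound et lf0 CA0 hA htau.
have T := C2_taylor d1 Cphi0 hphi (X b) (X a) (X tau).
have G := HC a tau b ta atau taub be.
have Q := Rintegral_germ lf0 CF0 hfAj ta atau taub be.
set E := (b - a) `^ (lam + gam) in G *.
have E0 : 0 <= E by exact: powR_ge0.
have Q' : CF * (b - a) `^ (1 + lf) <= CF * E.
  by rewrite ler_wpM2l//; apply: powR_le_exponent.
pose y := (b - a) `^ gam.
have y0 : 0 <= y by exact: powR_ge0.
have Xy p q : a <= p -> p <= b -> a <= q -> q <= b -> `|X p - X q| <= CX * y.
  move=> ap pb aq qb; apply: le_trans (HX p q _ _) _; rewrite ?(le_trans ta)//= ?(le_trans _ be)//.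
  rewrite ler_wpM2l//; apply: ge0_ler_powR; rewrite ?nnegrE ?normr_ge0 ?(andP ba1).1 ?(ltW gam0)//.
  by rewrite ler_norml opprB !lerB.
have yy : y * y <= E.
  rewrite /y -powRD; first exact: powR_le_exponent.
  by rewrite gt_eqF// addr_gt0.
have T' : `|phi (X b) - phi (X a) - (X b - X a) *m A tau| <= 2 * d%:R * Cphi * CX * CX * E.
  apply: le_trans T _.
  apply: (@le_trans _ _ (d%:R * Cphi * (CX * y + CX * y) * (CX * y))).
    apply: ler_pM => //; last exact: Xy.
      by rewrite !mulr_ge0// addr_ge0.
    by rewrite ler_wpM2l ?mulr_ge0// lerD// Xy.
  have -> : d%:R * Cphi * (CX * y + CX * y) * (CX * y) =
    2 * d%:R * Cphi * CX * CX * (y * y) by ring.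
  by rewrite ler_wpM2l// !mulr_ge0.
have G' : `|(X b - X a - (b - a) *: f tau - (g b - g a) *: k tau) *m A tau| <= d%:R * C * MA * E.
  apply: le_trans (mulmx_norm_le _ _) _; rewrite -!mulrA ler_wpM2l// (mulrC MA) mulrA.
  by apply: ler_pM.
move: Q; set Ib := Rintegral _ _ _; set Ia := Rintegral _ _ _ => Q.
have T'' := le_trans (mx_coord_le_norm _ 0 j) T'.
have G'' := le_trans (mx_coord_le_norm _ 0 j) G'.
rewrite /CI [leRHS]mulrDl [X in _ <= X + _]mulrDl;
  apply: le_trans (lerD (lerD T'' G'') (le_trans Q Q')).
rewrite -[X in _ <= _ + X]normrN.
apply: le_trans (le_trans (ler_normD _ _) (lerD (ler_normD _ _) (lexx _))).
rewrite !mulmxBl -!scalemxAl !mx_subE !mxE /I -/Ib -/Ia.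
by rewrite le_eqVlt; apply/orP; left; apply/eqP; congr `|_|; ring.
Qed.

(** * Measurable radii *)

(** [p, q] is cut into N equal pieces shorter than eta, each of which contributes at most C (q -
    p)^gam. *)
Lemma local_hoelder_global (R : realType) (g : R -> R) (C eta gam T : R) :
  0 <= C -> 0 < eta -> 0 <= gam ->
  (forall p q, 0 <= p <= T -> 0 <= q <= T -> `|p - q| < eta ->
    `|g p - g q| <= C * `|p - q| `^ gam) ->
  exists2 C' : R, 0 <= C' & forall p q, 0 <= p <= T -> 0 <= q <= T ->
    `|g p - g q| <= C' * `|p - q| `^ gam.
Proof.
move=> C0 eta0 gam0 hg.
pose N := (Num.trunc (T / eta)).+1.
have N0 : 0 < N%:R :> R by rewrite ltr0n.
have hN : T / N%:R < eta.
  by rewrite ltr_pdivrMr// mulrC -ltr_pdivrMr// truncnS_gt.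
exists (N%:R * C); first by rewrite mulr_ge0.
have step p q : 0 <= p -> p <= q -> q <= T -> `|g q - g p| <= N%:R * C * (q - p) `^ gam.
  move=> p0 pq qT.
  pose x (i : nat) := p + (q - p) * (i%:R / N%:R).
  have xN : x N = q by rewrite /x divff ?gt_eqF// mulr1 addrC subrK.
  have x0 : x 0%N = p by rewrite /x mul0r mulr0 addr0.
  have dx i : x i.+1 - x i = (q - p) / N%:R.
    by rewrite /x -[i.+1]addn1 natrD; field; rewrite gt_eqF.
  have xin i : (i <= N)%N -> 0 <= x i <= T.
    move=> iN; have i1 : i%:R / N%:R <= 1 :> R by rewrite ler_pdivrMr// mul1r ler_nat.
    have i0 : 0 <= i%:R / N%:R :> R by rewrite divr_ge0.
    rewrite /x addr_ge0//= ?mulr_ge0 ?subr_ge0//.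
    by rewrite (le_trans _ qT)// -lerBrDl ler_piMr// subr_ge0.
  have dN : 0 <= (q - p) / N%:R by rewrite divr_ge0 ?subr_ge0.
  have -> : g q - g p = \sum_(i < N) (g (x i.+1) - g (x i)).
    rewrite -(big_mkord xpredT (fun i => g (x i.+1) - g (x i))).
    by rewrite (telescope_sumr (fun i => g (x i)))// xN x0.
  apply: le_trans (ler_norm_sum _ _ _) _.
  apply: (@le_trans _ _ (\sum_(i < N) C * (q - p) `^ gam)); last first.
    by rewrite sumr_const card_ord -mulrA mulr_natl.
  apply: ler_sum => i _.
  apply: le_trans (hg _ _ (xin i.+1 (ltn_ord i)) (xin i (ltnW (ltn_ord i))) _) _.
    rewrite dx ger0_norm//; apply: le_lt_trans hN.
    by rewrite ler_pM2r ?invr_gt0// lerBlDr (le_trans qT)// lerDl.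
  rewrite dx ger0_norm// ler_wpM2l//; apply: ge0_ler_powR; rewrite ?nnegrE ?subr_ge0//.
  by rewrite ler_pdivrMr// ler_peMr ?subr_ge0// ler1n.
move=> p q /andP[p0 pT] /andP[q0 qT]; have [pq|/ltW qp] := leP p q.
  by rewrite distrC (distrC p) (@ger0_norm _ (q - p)) ?subr_ge0//; exact: step.
by rewrite (@ger0_norm _ (p - q)) ?subr_ge0//; exact: step.
Qed.

Lemma measurable_dyadic_sum (disp : measure_display) (Omega : measurableType disp)
    (R : realType) (D : set Omega) (f g : R -> Omega -> R) (n : nat) (a b : R) :
  (forall q, a <= q <= b -> measurable_fun D (f q)) ->
  (forall q, a <= q <= b -> measurable_fun D (g q)) -> a <= b ->
  measurable_fun D (fun w => dyadic_sum (f ^~ w) (g ^~ w) n a b).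
Proof.
elim: n a b => [|n IHn] a b mf mg ab /=.
  apply: measurable_funM; first by apply: mf; rewrite lexx.
  by apply: measurable_funB; apply: mg; rewrite ?lexx ab.
have ac : a <= (a + b) / 2 by lra.
have cb : (a + b) / 2 <= b by lra.
by apply: measurable_funD; apply: IHn => // q /andP[h1 h2]; (apply: mf || apply: mg);
  rewrite ?h1 ?h2 ?(le_trans h2)// ?(le_trans _ h1).
Qed.

Lemma is_RS_integral_ext (R : realType) (f f' g : R -> R) (a b I : R) :
  (forall q, a <= q <= b -> f q = f' q) ->
  is_RS_integral f g a b I -> is_RS_integral f' g a b I.
Proof.
move=> ff hI e e0; have [eta eta0 H] := hI e e0; exists eta => // s tau hs htau.
have -> : RS_sum f' g a s tau = RS_sum f g a s tau; last exact: H.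
apply: eq_bigr => -[i hi] _ /=; congr (_ * _); rewrite ff//.
have [_ h1 h2] := htau i hi; apply/andP; split.
  apply: le_trans h1; rewrite (set_nth_default b) /= ?ltnS 1?ltnW//.
  exact: (itv_partition_nth_ge (leqW hi) hs).
apply: (le_trans h2); rewrite (set_nth_default b) /= ?ltnS//.
by have := itv_partition_nth_le (hi : i.+1 < (size s).+1)%N hs; exact.
Qed.

Lemma is_RS_integral_refl (R : realType) (f g : R -> R) (a I : R) :
  is_RS_integral f g a a I -> I = 0.
Proof.
move=> hI; apply/eqP; rewrite -normr_eq0 eq_le normr_ge0 andbT.
apply/ler_addgt0Pr => e e0; rewrite add0r.
have [eta eta0 H] := left_sum_RS_integral hI e0.
by have /(_ isT erefl) := H [::]; rewrite /= sub0r normrN => /ltW.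
Qed.

Lemma first_index (disp : measure_display) (Omega : measurableType disp)
    (E : nat -> set Omega) :
  (forall n, measurable (E n)) -> (forall w, exists n, E n w) ->
  exists k : Omega -> nat, (forall n, measurable [set w | k w = n]) /\
    forall w, E (k w) w.
Proof.
move=> mE cE.
have ex w : exists n, `[< E n w >] by have [n En] := cE w; exists n; exact/asboolP.
exists (fun w => ex_minn (ex w)); split; last first.
  by move=> w; case: ex_minnP => n /asboolP.
move=> n.
rewrite [X in measurable X](_ : _ = E n `&` \bigcap_(m in `I_n) ~` E m).
  apply: measurableI => //; rewrite -[X in measurable X]setCK setC_bigcap.
  apply: measurableC; apply: bigcup_measurable => m _.
  by rewrite setCK.
apply/seteqP; split => w /=; case: ex_minnP => m /asboolP Em hm.
  move=> <-; split => // j /= jm Ej.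
  by have := hm j (introT (asboolP _) Ej); rewrite leqNgt jm.
move=> [En h]; apply/eqP; rewrite eqn_leq hm/=; last exact/asboolP.
by rewrite leqNgt; apply/negP => mn; exact: (h m mn Em).
Qed.

Lemma measurable_rational_modulus (disp : measure_display) (Omega : measurableType disp)
    (R : realType) (k : nat) (D : set Omega) (Z : R -> Omega -> 'rV[R]_k) (del kap : R) :
  measurable D ->
  (forall p i, 0 <= p <= del -> measurable_fun D (fun w => Z p w 0 i)) ->
  measurable (D `&` [set w | forall p q : rat,
    0 <= (ratr p : R) <= del -> 0 <= (ratr q : R) <= del ->
    `|Z (ratr p) w - Z (ratr q) w| <= `|(ratr p : R) - ratr q| `^ kap]).
Proof.
move=> mD mZ.
pose F (p q : rat) (i : 'I_k) : set Omega :=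
  if (0 <= (ratr p : R) <= del) && (0 <= (ratr q : R) <= del) then
    D `&` [set w | `|Z (ratr p) w 0 i - Z (ratr q) w 0 i| <= `|(ratr p : R) - ratr q| `^ kap]
  else D.
have mF p q i : measurable (F p q i).
  rewrite /F; case: ifPn => // /andP[hp hq].
  have mW : measurable_fun D (fun w => `|Z (ratr p) w 0 i - Z (ratr q) w 0 i|).
    by apply: measurableT_comp => //; apply: measurable_funB; exact: mZ.
  rewrite [X in measurable X](_ : _ = D `&` (fun w => `|Z (ratr p) w 0 i - Z (ratr q) w 0 i|) @^-1`
    `]-oo, `|(ratr p : R) - ratr q| `^ kap]%classic).
    exact: mW.
  by apply/seteqP; split => w /= [Dw]; rewrite in_itv.
rewrite [X in measurable X](_ : _ = D `&` \bigcap_(p in [set: rat]) \bigcap_(q in [set: rat])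
    \bigcap_(i in [set: 'I_k]) F p q i).
  have cap (G : rat -> set Omega) : (forall p, measurable (G p)) ->
      measurable (\bigcap_(p in [set: rat]) G p).
    move=> mG; rewrite -[X in measurable X]setCK setC_bigcap; apply: measurableC.
    by apply: bigcupT_measurable_rat => p; exact: measurableC.
  apply: measurableI => //; apply: (cap) => p; apply: (cap) => q.
  exact: fin_bigcap_measurable.
apply/seteqP; split => w /= [Dw] h; split => //.
  move=> p _ q _ i _; rewrite /F; case: ifPn => // /andP[hp hq]; split => //=.
  by rewrite -mx_subE; apply: le_trans (mx_coord_le_norm _ _ _) (h p q hp hq).
move=> p q hp hq; apply: mx_norm_le => [|i j]; first exact: powR_ge0.
by rewrite (ord1 i) mx_subE; have := h p I q I j I; rewrite /F hp hq => -[].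
Qed.

(** The Hoelder bound with constant [C] serves only as continuity and leaves no trace in the
    conclusion. The rationals approach p from above and q from below, so their distance does not
    exceed q - p. *)
Lemma rational_modulus_extend (R : realType) (k : nat) (z : R -> 'rV[R]_k)
    (C l kap del : R) : 0 <= C -> 0 < l -> 0 <= kap ->
  (forall p q, 0 <= p <= del -> 0 <= q <= del -> `|z p - z q| <= C * `|p - q| `^ l) ->
  (forall p q : rat, 0 <= (ratr p : R) <= del -> 0 <= (ratr q : R) <= del ->
    `|z (ratr p) - z (ratr q)| <= `|(ratr p : R) - ratr q| `^ kap) ->
  forall p q, 0 <= p <= del -> 0 <= q <= del -> `|z p - z q| <= `|p - q| `^ kap.
Proof.
move=> C0 l0 kap0 hz hrat.
have step p q : 0 <= p -> p < q -> q <= del -> `|z p - z q| <= (q - p) `^ kap.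
  move=> p0 pq qd; apply/ler_addgt0Pr => e e0.
  pose r := (e / 2 / (C + 1)) `^ l^-1.
  have C1 : 0 < C + 1 by lra.
  have r0 : 0 < r by rewrite powR_gt0// !divr_gt0.
  have hr s : 0 <= s -> s <= r -> C * s `^ l <= e / 2.
    move=> s0 sr; apply: (@le_trans _ _ (C * r `^ l)).
      by rewrite ler_wpM2l//; apply: ge0_ler_powR; rewrite ?nnegrE ?(ltW l0)// ltW.
    rewrite -powRrM mulVf ?gt_eqF// powRr1; last by rewrite !divr_ge0// ltW.
    by rewrite mulrA ler_pdivrMr// mulrC ler_wpM2l//; lra.
  pose d := Num.min r ((q - p) / 2).
  have d0 : 0 < d by rewrite lt_min r0/=; lra.
  have dr : d <= r by rewrite ge_min lexx.
  have dm : d <= (q - p) / 2 by rewrite ge_min lexx orbT.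
  have [p' /itvP hp'] : exists p' : rat, ratr p' \in `]p, (p + d)[.
    by apply: rat_in_itvoo; lra.
  have [q' /itvP hq'] : exists q' : rat, ratr q' \in `](q - d), q[.
    by apply: rat_in_itvoo; lra.
  have p1 : p < ratr p' by rewrite hp'.
  have p2 : ratr p' < p + d by rewrite hp'.
  have q1 : q - d < ratr q' by rewrite hq'.
  have q2 : ratr q' < q by rewrite hq'.
  move: p1 p2 q1 q2 => {hp' hq'} p1 p2 q1 q2.
  have ip' : 0 <= (ratr p' : R) <= del by apply/andP; split; lra.
  have iq' : 0 <= (ratr q' : R) <= del by apply/andP; split; lra.
  have h1 : `|z p - z (ratr p')| <= e / 2.
    apply: le_trans (hz _ _ _ ip') (hr _ _ _) => //; first by apply/andP; split; lra.
    by rewrite ler_norml; apply/andP; split; lra.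
  have h2 : `|z (ratr q') - z q| <= e / 2.
    apply: le_trans (hz _ _ iq' _) (hr _ _ _) => //; first by apply/andP; split; lra.
    by rewrite ler_norml; apply/andP; split; lra.
  have h3 : `|z (ratr p') - z (ratr q')| <= (q - p) `^ kap.
    apply: le_trans (hrat _ _ ip' iq') _.
    apply: ge0_ler_powR; rewrite ?nnegrE ?normr_ge0//; first by lra.
    by rewrite ler_norml; apply/andP; split; lra.
  apply: le_trans (ler_distD (z (ratr p')) _ _) _.
  apply: le_trans (lerD h1 (ler_distD (z (ratr q')) _ _)) _.
  by apply: le_trans (lerD (lexx _) (lerD h3 h2)) _; lra.
move=> p q /andP[p0 pd] /andP[q0 qd]; have [pq|qp|->] := ltgtP p q.
- by rewrite (distrC p) (@ger0_norm _ (q - p)) ?subr_ge0 ?(ltW pq)//; exact: step.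
- by rewrite distrC (@ger0_norm _ (p - q)) ?subr_ge0 ?(ltW qp)//; exact: step.
- by rewrite !subrr normr0 powR_ge0.
Qed.

(** For small r the factor C r^(l - kap) is at most 1: a smaller exponent is traded for the constant
    1. The case kap = 0 gives oscillation at most 1. *)
Lemma hoelder_exponent_drop (R : realType) (C l kap : R) : 0 <= C -> kap < l -> 0 <= kap ->
  exists2 eta : R, 0 < eta & forall r, 0 <= r -> r <= eta -> C * r `^ l <= r `^ kap.
Proof.
move=> C0 kl kap0.
have C1 : 0 < C + 1 by lra.
have lk : 0 < l - kap by lra.
exists ((C + 1)^-1 `^ (l - kap)^-1); first by rewrite powR_gt0// invr_gt0.
move=> r r0 hr.
move: r0; rewrite le_eqVlt => /predU1P[<-|r0].
  by rewrite powR0 ?mulr0 ?powR_ge0// gt_eqF//; lra.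
have -> : r `^ l = r `^ (l - kap) * r `^ kap.
  by rewrite -powRD ?subrK// (gt_eqF r0) implybT.
rewrite mulrA ler_piMl ?powR_ge0//.
apply: (@le_trans _ _ (C * (C + 1)^-1)).
  have lk1 : (l - kap)^-1 * (l - kap) = 1 by rewrite mulVf// gt_eqF.
  rewrite ler_wpM2l// -[leRHS]powRr1; last by rewrite invr_ge0 ltW.
  rewrite -[X in _ <= _ `^ X]lk1 powRrM.
  by apply: ge0_ler_powR; rewrite ?nnegrE ?powR_ge0 ?(ltW r0) ?(ltW lk).
by rewrite ler_pdivrMr// mul1r; lra.
Qed.

(** * Measurable paths *)

Definition path_approx (R : realType) (d : nat) (t : R) (x : 'rV[R]_d)
    (f k : R -> 'rV[R]_d) (g : R -> R) (s : R) (n : nat) (i : 'I_d) : R :=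
  x 0 i + dyadic_sum (fun q => f q 0 i) id n t s + dyadic_sum (fun q => k q 0 i) g n t s.

(* The paths are given a limit superior, which makes them measurable functions of
   the randomness; almost surely it is a limit. *)
Definition path_limit (R : realType) (d : nat) (t : R) (x : 'rV[R]_d)
    (f k : R -> 'rV[R]_d) (g : R -> R) (s : R) : 'rV[R]_d :=
  \row_i fine (limn_esup (fun n => (path_approx t x f k g s n i)%:E)).

Lemma path_limitE (R : realType) (d : nat) (t : R) (x y : 'rV[R]_d)
    (f k : R -> 'rV[R]_d) (g : R -> R) (s : R) :
  (forall i, path_approx t x f k g s n i @[n --> \oo] --> y 0 i) ->
  path_limit t x f k g s = y.
Proof.
move=> h; apply/rowP => i; rewrite mxE.
have : (path_approx t x f k g s n i)%:E @[n --> \oo] --> (y 0 i)%:E.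
  by apply: cvg_EFin; [exact: nearW|exact: h].
by move=> /cvg_limn_einf_sup[_ ->].
Qed.

Lemma path_limit_start (R : realType) (d : nat) (t : R) (x : 'rV[R]_d)
    (f k : R -> 'rV[R]_d) (g : R -> R) : path_limit t x f k g t = x.
Proof.
have D0 (p q : R -> R) n : dyadic_sum p q n t t = 0.
  elim: n => [|n IHn] /=; first by rewrite subrr mulr0.
  by have -> : (t + t) / 2 = t by [lra]; rewrite IHn addr0.
apply: path_limitE => i; rewrite /path_approx.
by under eq_fun do rewrite !D0 !addr0; exact: cvg_cst.
Qed.

Lemma measurable_path_limit (disp : measure_display) (Omega : measurableType disp)
    (R : realType) (d : nat) (t : R) (x : 'rV[R]_d)
    (f k : R -> Omega -> 'rV[R]_d) (g : R -> Omega -> R) (s : R) (D : set Omega) i :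
  t <= s ->
  (forall q i, t <= q <= s -> measurable_fun D (fun w => f q w 0 i)) ->
  (forall q i, t <= q <= s -> measurable_fun D (fun w => k q w 0 i)) ->
  (forall q, t <= q <= s -> measurable_fun D (g q)) ->
  measurable_fun D (fun w => path_limit t x (f ^~ w) (k ^~ w) (g ^~ w) s 0 i).
Proof.
move=> ts mf mk mg.
under eq_fun do rewrite mxE.
apply: (measurableT_comp (fine_measurable measurableT)).
apply: measurable_fun_limn_esup => n; apply/measurable_EFinP.
apply: measurable_funD; first apply: measurable_funD => //.
  apply: (@measurable_dyadic_sum _ _ _ _ (fun q w => f q w 0 i) (fun q _ => q)) => //.
  by move=> q hq; exact: mf.
by apply: (@measurable_dyadic_sum _ _ _ _ (fun q w => k q w 0 i) g) => // q hq; exact: mk.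
Qed.

(** The germ estimates make both dyadic sums converge, to the drift integral and to [J s - J t],
    where [J t = 0]. *)
Lemma path_limit_young (R : realType) (d : nat) (t e : R) (x : 'rV[R]_d)
    (f k J : R -> 'rV[R]_d) (g : R -> R) (Cf Ck Cg lf lam gam : R) :
  young_data t e f k J g Cf Ck Cg lf lam gam -> forall s, t <= s <= e ->
  path_limit t x f k g s = young_path t x f J s.
Proof.
move=> [et th1 lam0 lamlf lfgam gam1 Cf0 Ck0 Cg0 hf hk hg hJ] s hs; have /andP[ts se] := hs.
apply: path_limitE => i; rewrite /path_approx /young_path !mxE.
have lf0 : 0 < lf by lra.
have lf1 : 1 < 1 + lf by lra.
have gam0 : 0 <= gam by lra.
have hfi p q : t <= p <= e -> t <= q <= e -> `|f p 0 i - f q 0 i| <= Cf * `|p - q| `^ lf.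
  by move=> hp hq; rewrite -mx_subE; apply: le_trans (mx_coord_le_norm _ _ _) (hf _ _ hp hq).
have hki p q : t <= p <= e -> t <= q <= e -> `|k p 0 i - k q 0 i| <= Ck * `|p - q| `^ lam.
  by move=> hp hq; rewrite -mx_subE; apply: le_trans (mx_coord_le_norm _ _ _) (hk _ _ hp hq).
apply: cvgD; first (apply: cvgD; first exact: cvg_cst).
  pose I r := \int[@lebesgue_measure R]_(q in `[t, r]) f q 0 i.
  have -> : \int[@lebesgue_measure R]_(q in `[t, s]) f q 0 i = I s - I t.
    by rewrite /I set_itv1 Rintegral_set1 subr0.
  apply: (dyadic_sum_cvg lf1 ts) => a b ta ab bs.
  exact: (Rintegral_germ lf0 Cf0 hfi ta (lexx a) ab (le_trans bs se)).
have [K K0 H] := RS_integral_young th1 (ltW lam0) gam0 Ck0 Cg0 hki hg (fun s => hJ s i).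
have -> : J s 0 i = J s 0 i - J t 0 i.
  by rewrite (is_RS_integral_refl (hJ t i _)) ?subr0// lexx (le_trans ts).
apply: (dyadic_sum_cvg (I := fun r => J r 0 i) th1 ts) => a b ta ab bs.
exact: (H a a b ta (lexx a) ab (le_trans bs se)).
Qed.

(** Stopping time at T is 1-Lipschitz, so stopped processes keep their Hoelder constants. *)
Lemma clamp_dist (R : realType) (a b T : R) : `|Num.min a T - Num.min b T| <= `|a - b|.
Proof.
rewrite /Order.min; case: ltP => aT; case: ltP => bT; rewrite ?subrr ?normr0//.
  rewrite ler_norml; apply/andP; split; have := ler_norm (b - a); rewrite distrC; lra.
by rewrite ler_norml; apply/andP; split; have := ler_norm (a - b); lra.
Qed.

Lemma clamp_itv (R : realType) (t T p del : R) : t <= T -> 0 <= p <= del ->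
  t <= Num.min (t + p) T <= Num.min T (t + del).
Proof.
move=> tT /andP[p0 pd]; rewrite le_min tT lerDl p0/= le_min.
by rewrite !ge_min lexx orbT/= lerD2l pd.
Qed.

Lemma clamp_hoelder (R : realType) (p q : nat) (z : R -> 'M[R]_(p, q)) (C l t T del : R) :
  t <= T -> 0 <= C -> 0 <= l ->
  (forall r s, t <= r <= Num.min T (t + del) -> t <= s <= Num.min T (t + del) ->
     `|z r - z s| <= C * `|r - s| `^ l) ->
  forall r s, 0 <= r <= del -> 0 <= s <= del ->
  `|z (Num.min (t + r) T) - z (Num.min (t + s) T)| <= C * `|r - s| `^ l.
Proof.
move=> tT C0 l0 hz r s hr hs.
apply: le_trans (hz _ _ (clamp_itv tT hr) (clamp_itv tT hs)) _.
rewrite ler_wpM2l//; apply: ge0_ler_powR; rewrite ?nnegrE//.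
by apply: le_trans (clamp_dist _ _ _) _; rewrite opprD addrACA subrr add0r.
Qed.

Lemma mulmx_increment (R : realType) (d m : nat) (u u' : 'rV[R]_d) (A A' : 'M[R]_(d, m)) :
  `|u *m A - u' *m A'| <= d%:R * (`|u - u'| * `|A| + `|u'| * `|A - A'|).
Proof.
have -> : u *m A - u' *m A' = (u - u') *m A + u' *m (A - A').
  by rewrite mulmxBl mulmxBr addrA subrK.
rewrite mulrDr !mulrA; apply: le_trans (ler_normD _ _) _.
by apply: lerD; exact: mulmx_norm_le.
Qed.

Lemma young_path_moduli (R : realType) (d : nat) (t T del : R) (x : 'rV[R]_d)
    (f k J : R -> 'rV[R]_d) (g : R -> R) (Cf Ck Cg lf lam gam : R) :
  t <= T -> lf < gam ->
  young_data t (Num.min T (t + del)) f k J g Cf Ck Cg lf lam gam ->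
  let c p := Num.min (t + p) T in
  exists C : R, 0 <= C /\ forall p q, 0 <= p <= del -> 0 <= q <= del ->
    [/\ `|f (c p) - f (c q)| <= C * `|p - q| `^ lf,
        `|k (c p) - k (c q)| <= C * `|p - q| `^ lam &
        `|path_limit t x f k g (c p) - path_limit t x f k g (c q)| <= C * `|p - q| `^ gam].
Proof.
move=> tT lfgam Y c.
have [CX CX0 HX] := young_path_hoelder x Y.
have [_ th1 lam0 lamlf _ gam1 Cf0 Ck0 Cg0 hf hk _ _] := Y.
exists (Cf + Ck + CX); split; first by rewrite !addr_ge0.
move=> p q hp hq.
have [pp pq] := (clamp_itv tT hp, clamp_itv tT hq).
split.
- apply: le_trans (clamp_hoelder tT Cf0 _ hf hp hq) _; first by lra.
  by rewrite ler_wpM2r ?powR_ge0//; lra.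
- apply: le_trans (clamp_hoelder tT Ck0 _ hk hp hq) _; first by lra.
  by rewrite ler_wpM2r ?powR_ge0//; lra.
rewrite !(path_limit_young x Y)//.
apply: le_trans (clamp_hoelder tT CX0 _ HX hp hq) _; first by lra.
by rewrite ler_wpM2r ?powR_ge0//; lra.
Qed.

(** The exponent 0 expresses oscillation at most 1, as a zeroth power is 1 even at 0. Hence |F| <=
    |F 0| + 1 and |phi'(Z)| <= |phi'(Z 0)| + Cphi, and the product rule gives a constant in which,
    apart from [D], no Hoelder constant of F or Z occurs. *)
Lemma image_hoelder (R : realType) (d m : nat) (phi : 'rV[R]_d -> 'rV[R]_m)
    (F Z : R -> 'rV[R]_d) (Cphi D del kap l : R) :
  (forall y z, `|jacobian phi y - jacobian phi z| <= Cphi * `|y - z|) -> 0 <= Cphi ->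
  0 <= D -> 0 <= del <= 1 -> 0 < l -> l <= kap ->
  (forall p q, 0 <= p <= del -> 0 <= q <= del -> `|F p - F q| <= `|p - q| `^ 0) ->
  (forall p q, 0 <= p <= del -> 0 <= q <= del -> `|F p - F q| <= D * `|p - q| `^ l) ->
  (forall p q, 0 <= p <= del -> 0 <= q <= del -> `|Z p - Z q| <= `|p - q| `^ kap) ->
  forall p q, 0 <= p <= del -> 0 <= q <= del ->
  `|F p *m jacobian phi (Z p) - F q *m jacobian phi (Z q)| <=
    d%:R * (D * (`|jacobian phi (Z 0)| + Cphi) + (`|F 0| + 1) * Cphi) * `|p - q| `^ l.
Proof.
move=> hphi Cphi0 D0 /andP[del0 del1] l0 lkap hF1 hF hZ p q hp hq.
have h0 : 0 <= (0 : R) <= del by rewrite lexx.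
have dist1 r s : 0 <= r <= del -> 0 <= s <= del -> `|r - s| <= 1.
  move=> /andP[r0 r1] /andP[s0 s1]; rewrite ler_norml; apply/andP; split; lra.
have Fq : `|F q| <= `|F 0| + 1.
  rewrite -[F q](subrK (F 0)) addrC; apply: le_trans (ler_normD _ _) _.
  by rewrite lerD2l; have := hF1 q 0 hq h0; rewrite powRr0.
have ZE r s : 0 <= r <= del -> 0 <= s <= del -> `|Z r - Z s| <= `|r - s| `^ l.
  move=> hr hs; apply: le_trans (hZ r s hr hs) _; apply: powR_le_exponent => //.
  by rewrite normr_ge0 dist1.
have Zp : `|jacobian phi (Z p)| <= `|jacobian phi (Z 0)| + Cphi.
  rewrite -[jacobian phi (Z p)](subrK (jacobian phi (Z 0))) addrC.
  apply: le_trans (ler_normD _ _) _; rewrite lerD2l; apply: le_trans (hphi _ _) _.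
  rewrite ler_piMr//; apply: le_trans (ZE p 0 hp h0) _.
  have e1 : 1 `^ l = 1 :> R by rewrite powR1.
  by rewrite -[leRHS]e1; apply: ge0_ler_powR; rewrite ?nnegrE ?(ltW l0) ?dist1.
apply: le_trans (mulmx_increment _ _ _ _) _.
rewrite -mulrA ler_wpM2l// mulrDl; apply: lerD.
  by rewrite mulrAC; apply: ler_pM => //; exact: hF.
rewrite -mulrA; apply: ler_pM => //.
by apply: le_trans (hphi _ _) _; rewrite ler_wpM2l// ZE.
Qed.

(** Here [j0] stands for |phi'(0)|, [a0 + a1 * rho] for a bound of |u| or |v|, and [c] for the
    dimensional factors. The absolute value of rho and the final 1 ensure positivity for every real
    rho, as an admissible bound requires. *)
Definition image_bound (R : realType) (c j0 Cphi : R) (a0 a1 : R) (D : R) (rho : R) : R :=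
  c * (D * (j0 + Cphi * (`|rho| + 1)) + (a0 + a1 * `|rho| + 1) * Cphi) + 1.

Lemma image_bound_gt0 (R : realType) (c j0 Cphi a0 a1 D rho : R) :
  0 <= c -> 0 <= j0 -> 0 <= Cphi -> 0 <= a0 -> 0 <= a1 -> 0 <= D ->
  0 < image_bound c j0 Cphi a0 a1 D rho.
Proof.
move=> c0 j00 C0 a00 a10 D0; rewrite /image_bound ltr_wpDl// mulr_ge0//.
by rewrite addr_ge0// mulr_ge0// ?addr_ge0// ?mulr_ge0// addr_ge0.
Qed.

Lemma image_bound_ge (R : realType) (d m : nat) (j0 jx Cphi a0 a1 D rho rx u : R) :
  0 <= j0 -> 0 <= Cphi -> 0 <= a0 -> 0 <= a1 -> 0 <= D ->
  rx <= rho -> jx <= j0 + Cphi * rx -> u <= a0 + a1 * rx ->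
  m%:R * (d%:R * (D * (jx + Cphi) + (u + 1) * Cphi)) <=
  image_bound (m * d)%:R j0 Cphi a0 a1 D rho.
Proof.
move=> j00 C0 a00 a10 D0 rr hj hu; rewrite /image_bound natrM -(mulrA m%:R).
rewrite -[leLHS]addr0 lerD// ler_wpM2l// ler_wpM2l//.
have rn : rx <= `|rho| by apply: le_trans (ler_norm rho).
apply: lerD; [rewrite ler_wpM2l//|rewrite ler_wpM2r// lerD2r].
  rewrite mulrDr mulr1 addrA lerD2r; apply: le_trans hj _.
  by rewrite lerD2l ler_wpM2l.
by apply: le_trans hu _; rewrite lerD2l ler_wpM2l.
Qed.

Lemma measurable_image_bound (R : realType) (c j0 Cphi a0 a1 : R) (D : \bar R -> R) (rho : R) :
  measurable_fun setT D -> measurable_fun setT (fun lam => image_bound c j0 Cphi a0 a1 (D lam) rho).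
Proof.
move=> mD; rewrite /image_bound; apply: measurable_funD => //.
apply: measurable_funM => //; apply: measurable_funD => //.
exact: measurable_funM.
Qed.

Lemma jacobian_entry_continuous (R : realType) (d m : nat) (phi : 'rV[R]_d -> 'rV[R]_m) i j :
  (forall x, differentiable (jacobian phi) x) -> continuous (fun y => jacobian phi y i j).
Proof.
move=> d2 y; apply: (@continuous_comp _ _ _ (jacobian phi) (fun A : 'M[R]_(d, m) => A i j)).
  exact: differentiable_continuous.
exact: coord_continuous.
Qed.

Lemma measurable_image_coordinate (disp : measure_display) (Omega : measurableType disp)
    (R : realType) (d m : nat) (phi : 'rV[R]_d -> 'rV[R]_m) (D : set Omega)
    (f Z : Omega -> 'rV[R]_d) (y : 'rV[R]_m) j :
  (forall x, differentiable (jacobian phi) x) -> measurable D ->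
  (forall i, measurable_fun D (fun w => f w 0 i)) ->
  (forall i, measurable_fun D (fun w => Z w 0 i)) ->
  measurable_fun D (fun w => (f w *m jacobian phi (Z w) - y) 0 j).
Proof.
move=> d2 mD mf mZ; under eq_fun do rewrite mx_subE mxE.
apply: measurable_funB => //; apply: measurable_sum => i; apply: measurable_funM => //.
apply: (@measurable_fun_comp_continuous _ _ _ _ D Z (fun y => jacobian phi y i j)) => //.
exact: jacobian_entry_continuous.
Qed.

Lemma radius_selection (disp : measure_display) (Omega : measurableType disp)
    (R : realType) (h : Omega -> R) (A : nat -> set Omega) :
  measurable_fun setT h -> (forall w, 0 < h w) -> (forall n, measurable (A n)) ->
  (forall n, A n `<=` [set w | n.+1%:R^-1 <= h w]) ->
  exists2 k : Omega -> nat,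
    measurable_fun setT (fun w => (k w).+1%:R^-1 : R) /\ (forall w, (k w).+1%:R^-1 <= h w) &
    forall w, (exists n, A n w) -> A (k w) w.
Proof.
move=> mh h0 mA hA.
pose Hn n := [set w | n.+1%:R^-1 <= h w].
have mHn n : measurable (Hn n).
  rewrite [Hn n](_ : _ = setT `&` h @^-1` `[n.+1%:R^-1, +oo[%classic); first exact: mh.
  by rewrite setTI; apply/seteqP; split => w /=; rewrite in_itv/= andbT.
(* Outcomes that lie in no [A n] fall back on the size of [h] alone, so the radius is positive and
   at most [h] for every outcome. *)
pose E n := A n `|` (~` (\bigcup_i A i) `&` Hn n).
have mE n : measurable (E n).
  apply: measurableU => //; apply: measurableI => //; apply: measurableC.
  exact: bigcup_measurable.
have cE w : exists n, E n w.
  have [[n An]|nA] := pselect (exists n, A n w); first by exists n; left.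
  exists (Num.trunc (h w)^-1); right; split; first by move=> [n _ An]; apply: nA; exists n.
  by rewrite /Hn/= invf_ple ?posrE// ltW// truncnS_gt.
have [k [mk hk]] := first_index mE cE.
exists k.
  split.
    apply: (@measurable_fun_countable_factor _ _ _ nat setT k (fun n => n.+1%:R^-1)) => n.
    by rewrite setTI; exact: mk.
  by move=> w; have [/hA|[_]] := hk w.
move=> w [n An]; have [//|[nA _]] := hk w.
by exfalso; apply: nA; exists n.
Qed.

Lemma image_increment_enorm (R : realType) (d m : nat) (phi : 'rV[R]_d -> 'rV[R]_m)
    (F Z : R -> 'rV[R]_d) (y : 'rV[R]_m) (Cphi D del kap l a0 a1 rho : R) :
  (forall y z, `|jacobian phi y - jacobian phi z| <= Cphi * `|y - z|) -> 0 <= Cphi ->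
  0 <= D -> 0 <= del <= 1 -> 0 < l -> l <= kap ->
  (forall p q, 0 <= p <= del -> 0 <= q <= del -> `|F p - F q| <= `|p - q| `^ 0) ->
  (forall p q, 0 <= p <= del -> 0 <= q <= del -> `|F p - F q| <= D * `|p - q| `^ l) ->
  (forall p q, 0 <= p <= del -> 0 <= q <= del -> `|Z p - Z q| <= `|p - q| `^ kap) ->
  0 <= a0 -> 0 <= a1 -> `|F 0| <= a0 + a1 * enorm (Z 0) -> enorm (Z 0) <= rho ->
  forall p q, 0 <= p <= del -> 0 <= q <= del ->
  enorm ((F p *m jacobian phi (Z p) - y) - (F q *m jacobian phi (Z q) - y)) <=
    image_bound (m * d)%:R `|jacobian phi 0| Cphi a0 a1 D rho * `|p - q| `^ l.
Proof.
move=> hphi Cphi0 D0 hdel l0 lkap hF1 hF hZ a00 a10 hF0 hZ0 p q hp hq.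
rewrite opprB addrA subrK; apply: le_trans (enorm_le_mx_norm _) _; rewrite mul1n.
have H := image_hoelder hphi Cphi0 D0 hdel l0 lkap hF1 hF hZ hp hq.
apply: le_trans (ler_wpM2l _ H) _ => //; rewrite mulrA ler_wpM2r ?powR_ge0//.
apply: (image_bound_ge _ _ _ _ _ _ _ hZ0) => //.
rewrite -[jacobian phi (Z 0)](subrK (jacobian phi 0)) addrC.
apply: le_trans (ler_normD _ _) _; rewrite lerD2l; apply: le_trans (hphi _ _) _.
by rewrite subr0 ler_wpM2l// mx_norm_le_enorm.
Qed.

(** Comparison with sigma(0, 0) by the Lipschitz condition; t^beta <= 1 + T produces exactly
    M_{0,T}. *)
Lemma sigma_growth (R : realType) (d : nat) (T t beta delta M0 : R)
    (sigma : R -> 'rV[R]_d -> 'rV[R]_d) (M : R -> R) (x : 'rV[R]_d) :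
  assumption_H1 T sigma beta delta M0 M -> 0 <= t <= T ->
  `|sigma t x| <= `|M0T T sigma M0| + `|M0| * enorm x.
Proof.
move=> H1 /andP[t0 tT].
have T0 : 0 <= T by exact: le_trans tT.
have /andP[b0 b1] := H1_beta H1.
have M00 := ltW (H1_M0 H1).
have h0 : 0 <= (0 : R) <= T by rewrite lexx.
have ht : 0 <= t <= T by rewrite t0.
have L := H1_lip H1 x 0 h0 ht; rewrite !subr0 (ger0_norm t0) in L.
have tb : t `^ beta <= 1 + T.
  have [t1|/ltW t1] := leP t 1.
    apply: (@le_trans _ _ 1); last by rewrite lerDl.
    have e1 : 1 `^ beta = 1 :> R by rewrite powR1.
    by rewrite -[leRHS]e1; apply: ge0_ler_powR; rewrite ?nnegrE ?(ltW b0).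
  by apply: le_trans (ler1_powR t1 b1) _; rewrite (le_trans tT)// lerDr.
have n0 := mx_norm_le_enorm (sigma 0 0).
have n1 := mx_norm_le_enorm (sigma t x - sigma 0 0).
rewrite -[sigma t x](subrK (sigma 0 0)) (ger0_norm M00).
apply: le_trans (ler_normD _ _) _.
apply: (@le_trans _ _ (M0T T sigma M0 + M0 * enorm x)); last by rewrite lerD2r ler_norm.
have : M0 * t `^ beta <= M0 * (1 + T) by rewrite ler_wpM2l.
rewrite /M0T; move: (le_trans n1 L); rewrite mulrDr mulrDr mulr1 => z1 z2.
apply: le_trans (lerD (le_trans z1 (lerD z2 (lexx _))) n0) _.
by rewrite addrC addrA addrA.
Qed.

(** * The tangency condition *)

Lemma itv_dist_le (R : realType) (p q del : R) :
  0 <= p <= del -> 0 <= q <= del -> `|p - q| <= del.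
Proof.
by move=> /andP[p0 p1] /andP[q0 q1]; rewrite ler_norml; apply/andP; split; lra.
Qed.

(** [J'] is defined as what remains of phi(X) after the starting value and the drift, so the
    decomposition is immediate and the content is that [J'] is the integral. *)
Lemma image_young (R : realType) (d m : nat) (phi : 'rV[R]_d -> 'rV[R]_m)
    (t e s : R) (x : 'rV[R]_d)
    (f k J : R -> 'rV[R]_d) (g : R -> R) (Cphi Cf Ck Cg lf lam gam : R) :
  (forall y, differentiable phi y) -> 0 <= Cphi ->
  (forall y z, `|jacobian phi y - jacobian phi z| <= Cphi * `|y - z|) ->
  young_data t e f k J g Cf Ck Cg lf lam gam -> t <= s <= e ->
  let X := path_limit t x f k g in
  exists2 J' : 'rV[R]_m,
    forall j, is_RS_integral (fun q => (k q *m jacobian phi (X q)) 0 j) g t s (J' 0 j) &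
    phi (X s) = phi x +
      \row_j \int[@lebesgue_measure R]_(q in `[t, s]) (f q *m jacobian phi (X q)) 0 j + J'.
Proof.
move=> d1 Cphi0 hphi Y hs X; have /andP[ts se] := hs.
have XE q : t <= q <= s -> X q = young_path t x f J q.
  by move=> /andP[tq qs]; apply: (path_limit_young x Y); rewrite tq (le_trans qs).
exists (phi (X s) - phi x -
    \row_j \int[@lebesgue_measure R]_(q in `[t, s]) (f q *m jacobian phi (X q)) 0 j); last first.
  by rewrite -addrA [X in _ + X]addrC subrK addrC subrK.
move=> j; rewrite !mx_subE mxE.
have xE : x = young_path t x f J t by rewrite -XE ?lexx ?ts// [X t]path_limit_start.
rewrite [in phi x]xE (XE s) ?lexx ?ts//.
have -> : \int[@lebesgue_measure R]_(q in `[t, s]) (f q *m jacobian phi (X q)) 0 j =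
    \int[@lebesgue_measure R]_(q in `[t, s]) (f q *m jacobian phi (young_path t x f J q)) 0 j.
  by apply: eq_Rintegral => q; rewrite inE/= in_itv/= => /XE ->.
apply: is_RS_integral_ext (young_chain_rule x d1 Cphi0 hphi Y j hs).
by move=> q /XE ->.
Qed.
Theorem theorem3p1
  (disp : measure_display) (Omega : measurableType disp) (R : realType)
  (P : probability Omega R) (hP : measure_is_complete P)
  (T : R) (hT : 0 < T) (d m : nat) (hd : (1 <= d)%N) (hm : (1 <= m)%N)
  (H : R) (hH : 1 / 2 < H < 1)
  (B : R -> Omega -> R) (hB : fractional_brownian_motion P H B)
  (phi : 'rV[R]_d -> 'rV[R]_m) (hphi : C2_bounded_second_derivative phi)
  (D Dt : bound R) (hD : admissible_bound D) (hDt : admissible_bound Dt) :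
  exists D' Dt' : bound R,
    [/\ admissible_bound D', admissible_bound Dt' &
    forall (b sigma : R -> 'rV[R]_d -> 'rV[R]_d)
      (beta delta M0 mu L0 alpha : R) (M L : R -> R)
      (K : R -> set 'rV[R]_d) (t : R) (x : 'rV[R]_d),
      {within [set p : R * 'rV[R]_d | 0 <= p.1 <= T],
         continuous (fun p : R * 'rV[R]_d => b p.1 p.2)} ->
      {within [set p : R * 'rV[R]_d | 0 <= p.1 <= T],
         continuous (fun p : R * 'rV[R]_d => sigma p.1 p.2)} ->
      assumption_H1 T sigma beta delta M0 M ->
      assumption_H2 T b (alpha0 beta delta) mu L0 L ->
      1 - H < alpha < alpha0 beta delta ->
      (forall s, 0 <= s <= T -> closed (K s)) ->
      0 <= t <= T ->
      K t x ->
      tangent_set P B T alpha beta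
        (bound_at D L (M0T T sigma M0) M0 L0 T alpha beta)
        (bound_at Dt L (M0T T sigma M0) M0 L0 T alpha beta)
        K t x (enorm x)
        (b t x, sigma t x) ->
      tangent_set P B T alpha beta
        (bound_at D' L (M0T T sigma M0) M0 L0 T alpha beta)
        (bound_at Dt' L (M0T T sigma M0) M0 L0 T alpha beta)
        (fun s => phi @` K s) t (phi x) (enorm x)
        ('d phi x (b t x), 'd phi x (sigma t x))].
Proof.
have [d1 d2 _ _] := hphi.
have [Cphi Cphi0 hC] := jacobian_lipschitz hphi.
pose j0 := `|jacobian phi 0|.
have j00 : 0 <= j0 by exact: normr_ge0.
(* The coefficients come from |b(t, x)| <= L0 + L0 rho and |sigma(t, x)| <= M_{0,T} + M0 rho;
   absolute values make the bounds positive at arbitrary arguments. *)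
exists (fun rho Lr m0T m0 l0 T a b lam =>
  image_bound (m * d)%:R j0 Cphi `|l0| `|l0| (D rho Lr m0T m0 l0 T a b lam) rho).
exists (fun rho Lr m0T m0 l0 T a b lam =>
  image_bound (m * d)%:R j0 Cphi `|m0T| `|m0| (Dt rho Lr m0T m0 l0 T a b lam) rho).
split.
- move=> rho Lr m0T m0 l0 T' a b; have [D0 mD] := hD rho Lr m0T m0 l0 T' a b.
  by split; [move=> lam; apply: image_bound_gt0 => //; exact: ltW|exact: measurable_image_bound].
- move=> rho Lr m0T m0 l0 T' a b; have [D0 mD] := hDt rho Lr m0T m0 l0 T' a b.
  by split; [move=> lam; apply: image_bound_gt0 => //; exact: ltW|exact: measurable_image_bound].
move=> b sigma beta delta M0 mu L0 alpha M L K t x _ _ H1 H2 /andP[Ha aa0] _ ht Ktx.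
have /andP[t0 tT] := ht.
have [ha1 hab] : alpha < 1 / 2 /\ alpha < beta.
  by move: aa0; rewrite /alpha0 !lt_min => /andP[-> /andP[-> _]].
pose m0T := M0T T sigma M0.
have M00 := ltW (H1_M0 H1).
have L00 := ltW (H2_L0 H2).
have hh1 : H < 1 by case/andP: hH.
pose u := b t x; pose v := sigma t x.
have ub : `|u| <= `|L0| + `|L0| * enorm x.
  apply: le_trans (mx_norm_le_enorm _) _.
  by apply: le_trans (H2_growth H2 x ht) _; rewrite mulrDr mulr1 (ger0_norm L00).
have vb : `|v| <= `|m0T| + `|M0| * enorm x by exact: sigma_growth H1 ht.
pose lam := Num.min beta (1 - alpha).
(* The midpoint of 1 - alpha and H, which are in this order because 1 - H < alpha. Together with lam
   > alpha it gives lam + gam > 1. *)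
pose gam := (1 - alpha + H) / 2.
have lama : alpha < lam by rewrite lt_min hab/=; lra.
have lam0 : 0 < lam by lra.
have lamlf : lam <= 1 - alpha by rewrite ge_min lexx orbT.
have lfgam : 1 - alpha < gam by rewrite /gam; lra.
have gamH : gam < H by rewrite /gam; lra.
have gam1 : gam <= 1 by rewrite /gam; lra.
have th1 : 1 < lam + gam by rewrite /gam; lra.
have gam0 : 0 < gam by lra.
have lf0 : 0 < 1 - alpha by lra.
move=> [h [U [V [[mh h0] mU mV UV0 Hae]]]].
pose c s := Num.min s T.
pose f q w := u + U q w.
pose k q w := v + V q w.
pose X s w := path_limit t x (f ^~ w) (k ^~ w) (B ^~ w) s.
have Xt w : X t w = x by exact: path_limit_start.
have ct : c t = t by rewrite /c min_l.
have ftE w : f t w = u by rewrite /f (UV0 w).1 addr0.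
have ktE w : k t w = v by rewrite /k (UV0 w).2 addr0.
have mhle (r : Omega -> R) s : measurable_fun setT r -> measurable [set w | s <= r w].
  move=> mr; rewrite [X in measurable X](_ : _ = setT `&` r @^-1` `[s, +oo[%classic).
    exact: mr.
  by rewrite setTI; apply/seteqP; split => w /=; rewrite in_itv/= andbT.
have mth s : measurable [set w | s <= t + h w] by apply: mhle; exact: measurable_funD.
have mf s (D0 : set Omega) i : t <= s -> D0 `<=` [set w | s <= t + h w] ->
    measurable_fun D0 (fun w => f s w 0 i).
  move=> ts DS; apply: measurable_funS (mth s) DS _.
  have -> : (fun w => f s w 0 i) = (fun w => u 0 i + U s w 0 i).
    by apply/funext => w; rewrite /f mxE.
  by apply: measurable_funD => //; exact: mU.
have mk s (D0 : set Omega) i : t <= s -> D0 `<=` [set w | s <= t + h w] ->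
    measurable_fun D0 (fun w => k s w 0 i).
  move=> ts DS; apply: measurable_funS (mth s) DS _.
  have -> : (fun w => k s w 0 i) = (fun w => v 0 i + V s w 0 i).
    by apply/funext => w; rewrite /k mxE.
  by apply: measurable_funD => //; exact: mV.
have mX s (D0 : set Omega) i : t <= s -> D0 `<=` [set w | s <= t + h w] ->
    measurable_fun D0 (fun w => X s w 0 i).
  move=> ts DS; rewrite /X; apply: measurable_path_limit => //.
  - move=> q j /andP[tq qs]; apply: mf => //; apply: (subset_trans DS) => w /=.
    exact: le_trans.
  - move=> q j /andP[tq qs]; apply: mk => //; apply: (subset_trans DS) => w /=.
    exact: le_trans.
  - move=> q /andP[tq _]; apply: measurable_funTS; apply: (fbm_measurable hB).
    exact: le_trans tq.
pose del n : R := n.+1%:R^-1.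
pose Hn n := [set w | del n <= h w].
(* The restriction to [Hn n] keeps every time involved inside [t, t + h], where U and V are
   measurable. *)
pose mod (Z : R -> Omega -> 'rV[R]_d) n kap := Hn n `&` [set w | forall p q : rat,
  0 <= (ratr p : R) <= del n -> 0 <= (ratr q : R) <= del n ->
  `|Z (c (t + ratr p)) w - Z (c (t + ratr q)) w| <= `|(ratr p : R) - ratr q| `^ kap].
pose A n := mod f n 0 `&` mod k n 0 `&` mod X n (1 - alpha).
have mHn n : measurable (Hn n) by exact: mhle.
have tc s : t <= s -> t <= c s by move=> ts; rewrite /c le_min ts.
have cle s : c s <= s by rewrite /c ge_min lexx.
have mmod (Z : R -> Omega -> 'rV[R]_d) n kap :
    (forall s (D0 : set Omega) i, t <= s -> D0 `<=` [set w | s <= t + h w] ->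
      measurable_fun D0 (fun w => Z s w 0 i)) -> measurable (mod Z n kap).
  move=> mZ; apply: (measurable_rational_modulus (Z := fun p => Z (c (t + p)))) => //.
  move=> p i /andP[p0 pd]; apply: mZ; first by rewrite tc// lerDl.
  by move=> w hw; apply: le_trans (cle _) _; rewrite lerD2l (le_trans pd).
have mA n : measurable (A n).
  by apply: measurableI; [apply: measurableI|]; exact: mmod.
have AH n : A n `<=` Hn n by move=> w [[[]]].
have [kk [mkk hkk] Akk] := radius_selection mh h0 mA AH.
pose h' w := del (kk w).
exists h', (fun s w => f (c s) w *m jacobian phi (X (c s) w) - 'd phi x u),
  (fun s w => k (c s) w *m jacobian phi (X (c s) w) - 'd phi x v).
split.
- by split => // w; rewrite /h'/del.
- move=> s j ts; have h't : measurable [set w | s <= t + h' w].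
    by apply: mhle; exact: measurable_funD.
  have sub : [set w | s <= t + h' w] `<=` [set w | c s <= t + h w].
    move=> w /= hw; apply: le_trans (cle _) _; apply: le_trans hw _.
    by rewrite lerD2l hkk.
  apply: measurable_image_coordinate => // i; first by apply: mf => //; exact: tc.
  by apply: mX => //; exact: tc.
- move=> s j ts; have h't : measurable [set w | s <= t + h' w].
    by apply: mhle; exact: measurable_funD.
  have sub : [set w | s <= t + h' w] `<=` [set w | c s <= t + h w].
    move=> w /= hw; apply: le_trans (cle _) _; apply: le_trans hw _.
    by rewrite lerD2l hkk.
  apply: measurable_image_coordinate => // i; first by apply: mk => //; exact: tc.
  by apply: mX => //; exact: tc.
- by move=> w; rewrite ct ftE ktE Xt /jacobian !mul_rV_lin1 !subrr.
move=> rho rho0 xrho.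
have hB' := fbm_hoelder hB gam0 gamH hT.
apply: filterS2 (Hae rho rho0 xrho) hB' => w hw [CB0 [eta [CB00 eta0 hB0]]].
have [CB CBge hBw] := local_hoelder_global CB00 eta0 (ltW gam0) hB0.
set lamw := Lambda alpha T (B ^~ w) in hw *.
set DU := bound_at D _ _ _ _ _ _ _ _ _ in hw.
set DV := bound_at Dt _ _ _ _ _ _ _ _ _ in hw.
have DU0 : 0 < DU by exact: (hD rho (L rho) m0T M0 L0 T alpha beta).1.
have DV0 : 0 < DV by exact: (hDt rho (L rho) m0T M0 L0 T alpha beta).1.
pose d0 := Num.min (h w) 1.
(* The cut at 1 serves the length condition of [young_data]; radii 1 / (n + 1) respect it
   automatically. *)
have d00 : 0 < d0 by rewrite lt_min h0 ltr01.
have d0h : d0 <= h w by rewrite ge_min lexx.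
have d01 : d0 <= 1 by rewrite ge_min lexx orbT.
pose e0 := Num.min T (t + d0).
have e0T : e0 <= T by rewrite ge_min lexx.
have e0h q : q <= e0 -> q <= t + h w.
  by move=> qe; apply: (le_trans qe); rewrite ge_min lerD2l d0h orbT.
(* The outcome is fixed here, so the integrals may be chosen freely at each time; measurability
   rests on [X] alone. *)
have /choice[J hJ] : forall s, exists J : 'rV[R]_d, t <= s <= e0 ->
    (forall i, is_RS_integral (fun q => k q w 0 i) (B ^~ w) t s (J 0 i)) /\
    K s (x + \row_i (\int[@lebesgue_measure R]_(q in `[t, s]) (f q w 0 i)) + J).
  move=> s; have [/andP[ts se]|ns] := boolP (t <= s <= e0); last by exists 0.
  have hs : t <= s <= t + h w by rewrite ts e0h.
  have [_ _ /(_ (le_trans se e0T))[J [HJ KJ]]] := hw s s hs hs.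
  exists J => _; split.
    move=> i; apply: is_RS_integral_ext (HJ i) => q _.
    by rewrite /k mxE.
  move: KJ; congr (K s (_ + _ + _)).
  apply/rowP => i; rewrite !mxE; apply: eq_Rintegral => q _.
  by rewrite /f mxE.
have Yd : young_data t e0 (f ^~ w) (k ^~ w) J (B ^~ w) DU DV CB (1 - alpha) lam gam.
  split=> //; [|exact: ltW|exact: ltW|exact: ltW| | | |].
  - by rewrite ge_min lerD2l d01 orbT.
  - move=> p q /andP[tp pe] /andP[tq qe].
    have -> : f p w - f q w = U p w - U q w by rewrite /f opprD addrACA subrr add0r.
    apply: le_trans (mx_norm_le_enorm _) _.
    by have [] := hw p q; rewrite ?tp ?tq ?e0h.
  - move=> p q /andP[tp pe] /andP[tq qe].
    have -> : k p w - k q w = V p w - V q w by rewrite /k opprD addrACA subrr add0r.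
    apply: le_trans (mx_norm_le_enorm _) _.
    by have [] := hw p q; rewrite ?tp ?tq ?e0h.
  - move=> p q /andP[tp pe] /andP[tq qe]; apply: hBw.
      by rewrite (le_trans t0 tp) (le_trans pe).
    by rewrite (le_trans t0 tq) (le_trans qe).
  - by move=> s i hs; have [] := hJ s hs.
have [C [C0 HC]] := young_path_moduli x tT lfgam Yd.
(* Each of the exponents 1 - alpha, lam and gam exceeds its target 0, 0 and 1 - alpha, so a small
   enough radius absorbs the random constant [C]. *)
have exA : exists n, A n w.
  have [e1 e10 He1] := hoelder_exponent_drop C0 lf0 (lexx 0).
  have [e2 e20 He2] := hoelder_exponent_drop C0 lam0 (lexx 0).
  have [e3 e30 He3] := hoelder_exponent_drop C0 lfgam (ltW lf0).
  pose e' := Num.min d0 (Num.min e1 (Num.min e2 e3)).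
  have e'0 : 0 < e' by rewrite lt_min d00 lt_min e10 lt_min e20.
  pose n := Num.trunc e'^-1.
  have dn : del n <= e' by rewrite /del invf_ple ?posrE// ltW// truncnS_gt.
  have [n0 n1 n2 n3] : [/\ del n <= d0, del n <= e1, del n <= e2 & del n <= e3].
    have m1 : e' <= d0 by rewrite ge_min lexx.
    have m2 : e' <= Num.min e1 (Num.min e2 e3) by rewrite ge_min lexx orbT.
    by split; apply: (le_trans dn) => //; apply: (le_trans m2); rewrite !ge_min lexx ?orbT.
  have Hw : Hn n w by apply: le_trans d0h.

  have in0 p : 0 <= p <= del n -> 0 <= p <= d0.
    by move=> /andP[-> pd]; exact: le_trans n0.
  exists n; split; [split|]; split => // p q hp hq; have [g1 g2 g3] := HC _ _ (in0 _ hp) (in0 _ hq).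
  - by apply: le_trans g1 _; apply: He1 => //; apply: le_trans n1; exact: itv_dist_le.
  - by apply: le_trans g2 _; apply: He2 => //; apply: le_trans n2; exact: itv_dist_le.
  - by apply: le_trans g3 _; apply: He3 => //; apply: le_trans n3; exact: itv_dist_le.
have Aw := Akk w exA.
have h'h : h' w <= h w by exact: hkk.
have h'0 : 0 < h' w by rewrite /h'/del.
have h'1 : h' w <= 1 by rewrite /h'/del invf_le1// ler1n.
have h'd : h' w <= d0 by rewrite le_min h'h h'1.
have [[[_ mfw] [_ mkw]] [_ mXw]] := Aw.
have in0 p : 0 <= p <= h' w -> 0 <= p <= d0.
  by move=> /andP[-> pd]; exact: le_trans h'd.
have Ff := rational_modulus_extend (z := fun p => f (c (t + p)) w) C0 lf0 (lexx 0)
  (fun p q hp hq => let: And3 g _ _ := HC p q (in0 p hp) (in0 q hq) in g) mfw.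
have Fk := rational_modulus_extend (z := fun p => k (c (t + p)) w) C0 lam0 (lexx 0)
  (fun p q hp hq => let: And3 _ g _ := HC p q (in0 p hp) (in0 q hq) in g) mkw.
have FX := rational_modulus_extend (z := fun p => X (c (t + p)) w) C0 gam0 (ltW lf0)
  (fun p q hp hq => let: And3 _ _ g := HC p q (in0 p hp) (in0 q hq) in g) mXw.
(* Besides oscillation at most 1, the original constants [DU] and [DV] are kept: they, unlike [C],
   may appear in the new bounds. *)
have Hf p q (hp : 0 <= p <= h' w) (hq : 0 <= q <= h' w) :=
  clamp_hoelder tT (ltW DU0) (ltW lf0) (young_f Yd) (in0 p hp) (in0 q hq).
have Hk p q (hp : 0 <= p <= h' w) (hq : 0 <= q <= h' w) :=
  clamp_hoelder tT (ltW DV0) (ltW lam0) (young_k Yd) (in0 p hp) (in0 q hq).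
have hdel : 0 <= h' w <= 1 by rewrite ltW.
have X0 : X (c (t + 0)) w = x by rewrite addr0 ct Xt.
have f0 : f (c (t + 0)) w = u by rewrite addr0 ct ftE.
have k0 : k (c (t + 0)) w = v by rewrite addr0 ct ktE.
have IU := @image_increment_enorm _ _ _ phi (fun p => f (c (t + p)) w) (fun p => X (c (t + p)) w)
  ('d phi x u) Cphi DU (h' w) (1 - alpha) (1 - alpha) `|L0| `|L0| rho hC Cphi0 (ltW DU0)
  hdel lf0 (lexx _) Ff Hf FX (normr_ge0 _) (normr_ge0 _).
have IV := @image_increment_enorm _ _ _ phi (fun p => k (c (t + p)) w) (fun p => X (c (t + p)) w)
  ('d phi x v) Cphi DV (h' w) (1 - alpha) lam `|m0T| `|M0| rho hC Cphi0 (ltW DV0)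
  hdel lam0 lamlf Fk Hk FX (normr_ge0 _) (normr_ge0 _).
rewrite /= X0 f0 in IU; rewrite /= X0 k0 in IV.
have {}IU := IU ub xrho; have {}IV := IV vb xrho.
move=> s tau hs htau.
have shift q : t <= q <= t + h' w -> 0 <= q - t <= h' w.
  by move=> /andP[tq qh]; rewrite subr_ge0 tq lerBlDl.
have sE q : t + (q - t) = q by rewrite addrC subrK.
have stE : s - t - (tau - t) = s - tau by rewrite opprB addrA subrK.
split.
- by have := IU _ _ (shift s hs) (shift tau htau); rewrite !sE stE.
- by have := IV _ _ (shift s hs) (shift tau htau); rewrite !sE stE.
move=> sT; have /andP[ts sh] := hs.
have hse : t <= s <= e0.
  by rewrite ts le_min sT/= (le_trans sh)// lerD2l.
have [J' HJ' EJ'] := image_young x d1 Cphi0 hC Yd hse.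
have cq q : q <= s -> c q = q by move=> qs; rewrite /c min_l// (le_trans qs).
exists J'; split.
  move=> j; apply: is_RS_integral_ext (HJ' j) => q /andP[_ qs].
  by rewrite mx_subE (cq q qs) addrC subrK.
(* The path itself is the required preimage: it equals the Young path, which lies in [K s] by
   tangency. *)
exists (X s w).
  rewrite /X (path_limit_young x Yd hse) /young_path.
  by have [_] := hJ s hse.
rewrite [LHS]EJ'; congr (_ + _ + _); apply/rowP => j; rewrite !mxE.
apply: eq_Rintegral => q; rewrite inE/= in_itv/= => /andP[_ qs].
by rewrite mx_subE (cq q qs) addrC subrK.
Qed.
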